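(* Let $\mathcal{L}$ be a language extending the language of arithmetic by finitely many relation symbols and finitely many constants, let $\mathcal{M}\models \mathrm{PA}(\mathcal{L})$ be countable, and let $b\in M$ be an element that is not definable (without parameters) in $\mathcal{M}$. Then the Scott rank of $\mathcal{M}$ is strictly greater than $\omega$.
   Context: $\mathrm{PA}(\mathcal{L})$ is the extension of Peano arithmetic in the language $\mathcal{L}$ containing the full induction scheme for all $\mathcal{L}$-formulas. Infinitary formulas of $L_{\omega_1,\omega}$ are classified as follows: $\Pi^{in}_0=\Sigma^{in}_0$ are the finitary quantifier-free formulas; for $\alpha>0$, $\Sigma^{in}_\alpha$ formulas are (equivalent to) countable disjunctions $\bigvee_i\exists\bar x\,\psi_i(\bar x)$ with $\psi_i\in\Pi^{in}_{\gamma_i}$, $\gamma_i<\alpha$, and $\Pi^{in}_\alpha$ formulas are countable conjunctions $\bigwedge_i\forall\bar x\,\psi_i(\bar x)$ with $\psi_i\in\Sigma^{in}_{\gamma_i}$, $\gamma_i<\alpha$. A Scott sentence of a countable structure $\mathcal{A}$ is an $L_{\omega_1,\omega}$ sentence whose countable models are exactly the structures isomorphic to $\mathcal{A}$. The Scott rank of $\mathcal{A}$ is the least $\alpha$ such that $\mathcal{A}$ has a $\Pi^{in}_{\alpha+1}$ Scott sentence (equivalently, the least $\alpha$ such that every automorphism orbit of a tuple is $\Sigma^{in}_\alpha$-definable without parameters). *)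

(* Defs.v *)
From mathcomp Require Import all_boot.

Set Implicit Arguments.
Unset Strict Implicit.
Unset Printing Implicit Defensive.

(* The language {0, 1, +, *, <} of arithmetic, extended by the finitely many
   relation symbols [rel_sym] and the finitely many constants [cst_sym]. *)
Record language := Language {
  rel_sym : finType;
  arity : rel_sym -> nat;
  cst_sym : finType
}.

Record structure (L : language) := Structure {
  carrier :> Type;
  zero_of : carrier;
  one_of : carrier;
  add_of : carrier -> carrier -> carrier;
  mul_of : carrier -> carrier -> carrier;
  lt_of : carrier -> carrier -> Prop;
  rel_of : forall r : rel_sym L, (arity r).-tuple carrier -> Prop;
  cst_of : cst_sym L -> carrier
}.

Definition countable_structure L (A : structure L) : Prop :=
  exists f : A -> nat, injective f.

Definition is_isomorphism L (A B : structure L) (h : A -> B) : Prop :=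
  bijective h /\
  h (zero_of A) = zero_of B /\
  h (one_of A) = one_of B /\
  (forall x y, h (add_of x y) = add_of (h x) (h y)) /\
  (forall x y, h (mul_of x y) = mul_of (h x) (h y)) /\
  (forall x y, lt_of x y <-> lt_of (h x) (h y)) /\
  (forall (r : rel_sym L) (t : (arity r).-tuple A),
      rel_of t <-> rel_of (map_tuple h t)) /\
  (forall c : cst_sym L, h (cst_of A c) = cst_of B c).

Definition isomorphic L (A B : structure L) : Prop :=
  exists h : A -> B, is_isomorphism h.

(* Variables are de Bruijn indices: a quantifier binds index 0 of its scope. *)
Inductive term (L : language) :=
| tVar of nat
| tZero
| tOne
| tAdd of term L & term L
| tMul of term L & term L
| tCst of cst_sym L.

Arguments tVar {L}.
Arguments tZero {L}.
Arguments tOne {L}.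

(* Formulas of L_{omega_1, omega}; the first-order L-formulas are those
   satisfying [finitary].  Finite conjunctions and disjunctions may be padded
   by repetition to be nat-indexed. *)
Inductive formula (L : language) :=
| fEq of term L & term L
| fLt of term L & term L
| fRel (r : rel_sym L) of (arity r).-tuple (term L)
| fNeg of formula L
| fAnd of formula L & formula L
| fOr of formula L & formula L
| fEx of formula L
| fAll of formula L
| fBigAnd of (nat -> formula L)
| fBigOr of (nat -> formula L).

Fixpoint finitary L (phi : formula L) : bool :=
  match phi with
  | fEq _ _ | fLt _ _ | fRel _ _ => true
  | fNeg p | fEx p | fAll p => finitary p
  | fAnd p q | fOr p q => finitary p && finitary q
  | fBigAnd _ | fBigOr _ => false
  end.

Fixpoint quantifier_free L (phi : formula L) : Prop :=
  match phi with
  | fEq _ _ | fLt _ _ | fRel _ _ => True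
  | fNeg p => quantifier_free p
  | fAnd p q | fOr p q => quantifier_free p /\ quantifier_free q
  | fEx _ | fAll _ => False
  | fBigAnd f | fBigOr f => forall i, quantifier_free (f i)
  end.

Fixpoint term_below L (n : nat) (t : term L) : bool :=
  match t with
  | tVar i => i < n
  | tZero | tOne | tCst _ => true
  | tAdd u v | tMul u v => term_below n u && term_below n v
  end.

(* All free variables of [phi] have index < n.  A formula closed in this sense
   has only subformulas with finitely many free variables, as each subformula
   lies under finitely many quantifiers. *)
Fixpoint free_below L (n : nat) (phi : formula L) : Prop :=
  match phi with
  | fEq t u | fLt t u => term_below n t && term_below n u
  | fRel _ ts => all (term_below n) ts
  | fNeg p => free_below n p
  | fAnd p q | fOr p q => free_below n p /\ free_below n q
  | fEx p | fAll p => free_below n.+1 p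
  | fBigAnd f | fBigOr f => forall i, free_below n (f i)
  end.

Definition sentence L (phi : formula L) : Prop := free_below 0 phi.

Definition env_cons (T : Type) (a : T) (s : nat -> T) : nat -> T :=
  fun i => if i is j.+1 then s j else a.

Fixpoint eval L (A : structure L) (s : nat -> A) (t : term L) : A :=
  match t with
  | tVar i => s i
  | tZero => zero_of A
  | tOne => one_of A
  | tAdd u v => add_of (eval s u) (eval s v)
  | tMul u v => mul_of (eval s u) (eval s v)
  | tCst c => cst_of A c
  end.

Fixpoint sat L (A : structure L) (s : nat -> A) (phi : formula L) : Prop :=
  match phi with
  | fEq t u => eval s t = eval s u
  | fLt t u => lt_of (eval s t) (eval s u)
  | fRel _ ts => rel_of (map_tuple (eval s) ts)
  | fNeg p => ~ sat s p
  | fAnd p q => sat s p /\ sat s q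
  | fOr p q => sat s p \/ sat s q
  | fEx p => exists a : A, sat (env_cons a s) p
  | fAll p => forall a : A, sat (env_cons a s) p
  | fBigAnd f => forall i, sat s (f i)
  | fBigOr f => exists i, sat s (f i)
  end.

Definition models L (A : structure L) (phi : formula L) : Prop :=
  forall s : nat -> A, sat s phi.

(* The environment [s] supplies the parameters of the induction formula. *)
Record models_PA L (M : structure L) : Prop := ModelsPA {
  PA_succ_neq0 : forall x : M, add_of x (one_of M) <> zero_of M;
  PA_succ_inj : forall x y : M,
    add_of x (one_of M) = add_of y (one_of M) -> x = y;
  PA_add0 : forall x : M, add_of x (zero_of M) = x;
  PA_addS : forall x y : M,
    add_of x (add_of y (one_of M)) = add_of (add_of x y) (one_of M);
  PA_mul0 : forall x : M, mul_of x (zero_of M) = zero_of M;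
  PA_mulS : forall x y : M,
    mul_of x (add_of y (one_of M)) = add_of (mul_of x y) x;
  PA_lt : forall x y : M,
    lt_of x y <-> exists z : M, add_of x (add_of z (one_of M)) = y;
  PA_induction : forall (phi : formula L) (s : nat -> M), finitary phi ->
    sat (env_cons (zero_of M) s) phi ->
    (forall x : M, sat (env_cons x s) phi ->
       sat (env_cons (add_of x (one_of M)) s) phi) ->
    forall x : M, sat (env_cons x s) phi
}.

Definition definable_element L (A : structure L) (b : A) : Prop :=
  exists phi : formula L, finitary phi /\ free_below 1 phi /\
    forall (a : A) (s : nat -> A), sat (env_cons a s) phi <-> a = b.

(* [osup f] is the least ordinal above every [f i].  Distinct trees may denote
   the same ordinal; equality of ordinals is [ole] in both directions. *)
Inductive ordinal_tree : Type := osup (X : Type) (f : X -> ordinal_tree).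

Fixpoint ole (a b : ordinal_tree) : Prop :=
  match a, b with
  | osup X f, osup Y g => forall i : X, exists j : Y, ole (f i) (g j)
  end.

Definition olt (a b : ordinal_tree) : Prop :=
  match b with osup Y g => exists j : Y, ole a (g j) end.

Definition ozero : ordinal_tree := osup (fun e : Empty_set => match e with end).

Definition osucc (a : ordinal_tree) : ordinal_tree := osup (fun _ : unit => a).

Definition onat (n : nat) : ordinal_tree := iter n osucc ozero.

Definition oomega : ordinal_tree := osup onat.

Definition fExs L (k : nat) (phi : formula L) : formula L := iter k (@fEx L) phi.

Definition fAlls L (k : nat) (phi : formula L) : formula L :=
  iter k (@fAll L) phi.

(* In the second constructors, a > 0 is implied by g 0 < a. *)
Inductive Sigma_in (L : language) : ordinal_tree -> formula L -> Prop :=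
| Sigma_in_zero (a : ordinal_tree) (phi : formula L) :
    ole a ozero -> finitary phi -> quantifier_free phi -> Sigma_in a phi
| Sigma_in_pos (a : ordinal_tree) (g : nat -> ordinal_tree)
    (k : nat -> nat) (psi : nat -> formula L) :
    (forall i, olt (g i) a) -> (forall i, Pi_in (g i) (psi i)) ->
    Sigma_in a (fBigOr (fun i => fExs (k i) (psi i)))
with Pi_in (L : language) : ordinal_tree -> formula L -> Prop :=
| Pi_in_zero (a : ordinal_tree) (phi : formula L) :
    ole a ozero -> finitary phi -> quantifier_free phi -> Pi_in a phi
| Pi_in_pos (a : ordinal_tree) (g : nat -> ordinal_tree)
    (k : nat -> nat) (psi : nat -> formula L) :
    (forall i, olt (g i) a) -> (forall i, Sigma_in (g i) (psi i)) ->
    Pi_in a (fBigAnd (fun i => fAlls (k i) (psi i))).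

Definition scott_sentence L (A : structure L) (phi : formula L) : Prop :=
  sentence phi /\
  forall B : structure L, countable_structure B ->
    (models B phi <-> isomorphic A B).

Definition has_Pi_scott_sentence L (A : structure L) (a : ordinal_tree) : Prop :=
  exists phi : formula L, Pi_in a phi /\ scott_sentence A phi.

Definition is_scott_rank L (A : structure L) (a : ordinal_tree) : Prop :=
  has_Pi_scott_sentence A (osucc a) /\
  forall b : ordinal_tree, has_Pi_scott_sentence A (osucc b) -> ole a b.

(* Main.v *)
(* A countable structure has a Scott sentence, and every infinitary formula is
   equivalent to a Pi_(a+1) one for some a, so the Scott rank exists; by totality
   of the order on ordinals it remains to refute a Pi_(omega+1) Scott sentence
   phi of M.

   Pairing lets a single element of M code a finite tuple.  Let E n be the n-th
   back-and-forth relation on M; it preserves the formulas of level n.  For c in M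
   let R n c be its definable approximation, which only asks for a coded partial
   isomorphism closed under c levels of terms.  If c is nonstandard then R n c
   refines E n; if c is standard then R n c is implied by agreement on a finite
   list of formulas.  When b is undefinable the least element agreeing with b on
   such a list is smaller than b, so overspill gives a nonstandard c and some
   x < b with R n c x b.  Taking c largest and then x least makes x a definable
   function of b, and a definable 2-colouring separating every element from its
   smaller image (Ehrenfeucht's lemma) shows that x and b have different complete
   types, although E n x b.

   Hence the type of b can be omitted: build a countable model from finite tuples
   of M known only up to E n, with n growing.  Each instance of phi chooses a
   disjunct of finite level, so it is met by raising n, and each element of the
   new model is moved within its E n-class away from the type of b.  The result is
   a countable model of phi that is not isomorphic to M. *)

Require Import Defs.
From mathcomp Require Import all_boot.
From Stdlib Require Import Classical ClassicalEpsilon FunctionalExtensionality Ring.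

Set Implicit Arguments.
Unset Strict Implicit.
Unset Printing Implicit Defensive.

(** * Invariance of satisfaction under change of environment, isomorphism and renaming *)

Lemma eval_free L (A : structure L) n (t : term L) (s s' : nat -> A) :
  term_below n t -> (forall i, i < n -> s i = s' i) -> eval s t = eval s' t.
Proof.
move=> + ss'; elim: t => //= t IHt u IHu;
  by case/andP=> /IHt-> /IHu->.
Qed.

Lemma env_cons_free (T : Type) n (s s' : nat -> T) a :
  (forall i, i < n -> s i = s' i) ->
  forall i, i < n.+1 -> env_cons a s i = env_cons a s' i.
Proof. by move=> ss' [|i] //= /ss'. Qed.

Lemma sat_free L (A : structure L) (phi : formula L) n (s s' : nat -> A) :
  free_below n phi -> (forall i, i < n -> s i = s' i) ->
  sat s phi <-> sat s' phi.
Proof.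
elim: phi n s s' => /=.
- by move=> t u n s s' /andP[ft fu] ss'; rewrite (eval_free ft ss') (eval_free fu ss').
- by move=> t u n s s' /andP[ft fu] ss'; rewrite (eval_free ft ss') (eval_free fu ss').
- move=> r ts n s s' /all_tnthP fts ss'.
  suff -> : map_tuple (eval s) ts = map_tuple (eval s') ts by [].
  apply: eq_from_tnth => i; rewrite !tnth_map.
  exact: eval_free (fts i) ss'.
- by move=> p IH n s s' fp ss'; have := IH n s s' fp ss'; tauto.
- move=> p IHp q IHq n s s' [fp fq] ss'.
  by have := IHp n s s' fp ss'; have := IHq n s s' fq ss'; tauto.
- move=> p IHp q IHq n s s' [fp fq] ss'.
  by have := IHp n s s' fp ss'; have := IHq n s s' fq ss'; tauto.
- move=> p IH n s s' fp ss'.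
  by split=> -[a Ha]; exists a; apply/(IH _ _ _ fp (env_cons_free a ss')).
- move=> p IH n s s' fp ss'.
  by split=> Ha a; apply/(IH _ _ _ fp (env_cons_free a ss')).
- move=> f IH n s s' fp ss'.
  by split=> Ha i; apply/(IH i n s s' (fp i) ss').
- move=> f IH n s s' fp ss'.
  by split=> -[i Ha]; exists i; apply/(IH i n s s' (fp i) ss').
Qed.

Lemma env_cons_comp (T U : Type) (h : T -> U) a (s : nat -> T) :
  h \o env_cons a s = env_cons (h a) (h \o s).
Proof. by apply: functional_extensionality; case. Qed.

Lemma eval_iso L (A B : structure L) (h : A -> B) (s : nat -> A) t :
  is_isomorphism h -> h (eval s t) = eval (h \o s) t.
Proof.
case=> _ [h0 [h1 [hD [hM [_ [_ hc]]]]]].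
by elim: t => //= t IHt u IHu; rewrite ?hD ?hM IHt IHu.
Qed.

Lemma sat_iso L (A B : structure L) (h : A -> B) (phi : formula L) (s : nat -> A) :
  is_isomorphism h -> sat s phi <-> sat (h \o s) phi.
Proof.
move=> hiso; have [[g hK gK] [_ [_ [_ [_ [hlt [hrel _]]]]]]] := hiso.
elim: phi s => /=.
- move=> t u s; rewrite -!eval_iso //; split=> [->//|/(congr1 g)]; by rewrite !hK.
- by move=> t u s; rewrite -!eval_iso //.
- move=> r ts s; rewrite hrel.
  suff -> : map_tuple h (map_tuple (eval s) ts) = map_tuple (eval (h \o s)) ts by [].
  by apply: eq_from_tnth => i; rewrite !tnth_map eval_iso.
- by move=> p IH s; rewrite IH.
- by move=> p IHp q IHq s; rewrite IHp IHq.
- by move=> p IHp q IHq s; rewrite IHp IHq.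
- move=> p IH s; split=> [[a /IH]|[a Ha]].
    by rewrite env_cons_comp; exists (h a).
  by exists (g a); apply/IH; rewrite env_cons_comp gK.
- move=> p IH s; split=> Ha a.
    by have /IH := Ha (g a); rewrite env_cons_comp gK.
  by apply/IH; rewrite env_cons_comp.
- by move=> f IH s; split=> Ha i; apply/IH.
- by move=> f IH s; split=> -[i Ha]; exists i; apply/IH.
Qed.

Section Renaming.

Variable L : language.

Fixpoint tren (r : nat -> nat) (t : term L) : term L :=
  match t with
  | tVar i => tVar (r i)
  | tAdd u v => tAdd (tren r u) (tren r v)
  | tMul u v => tMul (tren r u) (tren r v)
  | t => t
  end.

Definition upren (r : nat -> nat) : nat -> nat :=
  fun i => if i is j.+1 then (r j).+1 else 0.

Fixpoint ren (r : nat -> nat) (phi : formula L) : formula L :=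
  match phi with
  | fEq t u => fEq (tren r t) (tren r u)
  | fLt t u => fLt (tren r t) (tren r u)
  | fRel R ts => fRel (map_tuple (tren r) ts)
  | fNeg p => fNeg (ren r p)
  | fAnd p q => fAnd (ren r p) (ren r q)
  | fOr p q => fOr (ren r p) (ren r q)
  | fEx p => fEx (ren (upren r) p)
  | fAll p => fAll (ren (upren r) p)
  | fBigAnd f => fBigAnd (fun i => ren r (f i))
  | fBigOr f => fBigOr (fun i => ren r (f i))
  end.

Lemma eval_ren (A : structure L) (s : nat -> A) r t :
  eval s (tren r t) = eval (s \o r) t.
Proof. by elim: t => //= t -> u ->. Qed.

Lemma env_cons_upren (T : Type) (a : T) s r :
  env_cons a s \o upren r = env_cons a (s \o r).
Proof. by apply: functional_extensionality; case. Qed.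

Lemma sat_ren (A : structure L) phi (s : nat -> A) r :
  sat s (ren r phi) <-> sat (s \o r) phi.
Proof.
elim: phi s r => //=.
- by move=> t u s r; rewrite !eval_ren.
- by move=> t u s r; rewrite !eval_ren.
- move=> R ts s r.
  suff -> : map_tuple (eval s) (map_tuple (tren r) ts) = map_tuple (eval (s \o r)) ts by [].
  by apply: eq_from_tnth => i; rewrite !tnth_map eval_ren.
- by move=> p IH s r; rewrite IH.
- by move=> p IHp q IHq s r; rewrite IHp IHq.
- by move=> p IHp q IHq s r; rewrite IHp IHq.
- by move=> p IH s r; split=> -[a Ha]; exists a; move/IH: Ha || apply/IH;
    rewrite env_cons_upren.
- by move=> p IH s r; split=> Ha a; [have /IH := Ha a | apply/IH];
    rewrite env_cons_upren.
- by move=> f IH s r; split=> Ha i; apply/IH.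
- by move=> f IH s r; split=> -[i Ha]; exists i; apply/IH.
Qed.

Lemma finitary_ren phi r : finitary (ren r phi) = finitary phi.
Proof. by elim: phi r => //= p IHp q IHq r; rewrite IHp IHq. Qed.

Lemma term_below_ren k k' r t :
  (forall i, i < k -> r i < k') -> term_below k t -> term_below k' (tren r t).
Proof.
move=> rk; elim: t => //= t IHt u IHu;
  by case/andP=> /IHt-> /IHu->.
Qed.

Lemma free_below_ren phi k k' r :
  (forall i, i < k -> r i < k') -> free_below k phi -> free_below k' (ren r phi).
Proof.
elim: phi k k' r => /=.
- by move=> t u k k' r rk /andP[? ?]; rewrite !(term_below_ren rk).
- by move=> t u k k' r rk /andP[? ?]; rewrite !(term_below_ren rk).
- move=> R ts k k' r rk /all_tnthP fts; apply/all_tnthP => i.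
  by rewrite tnth_map; apply: term_below_ren rk _.
- by move=> p IH k k' r rk; apply: IH.
- by move=> p IHp q IHq k k' r rk [? ?]; split; [apply: IHp rk _|apply: IHq rk _].
- by move=> p IHp q IHq k k' r rk [? ?]; split; [apply: IHp rk _|apply: IHq rk _].
- by move=> p IH k k' r rk; apply: IH; case.
- by move=> p IH k k' r rk; apply: IH; case.
- by move=> f IH k k' r rk Hf i; apply: IH rk _.
- by move=> f IH k k' r rk Hf i; apply: IH rk _.
Qed.

End Renaming.

(** * Definable predicates and functions *)

Section Definability.

Variables (L : language) (A : structure L).

Implicit Types (P Q : (nat -> A) -> Prop) (t u : (nat -> A) -> A).

(** Definability is handled semantically, by closure properties of predicates on environments, so
    that arithmetic formulas need not be written with de Bruijn indices. *)
Definition dfn k P : Prop :=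
  exists phi : formula L,
    [/\ finitary phi, free_below k phi & forall s : nat -> A, sat s phi <-> P s].

(* A function is definable when its graph is; index 0 is the value. *)
Definition dtm k t : Prop := dfn k.+1 (fun s => s 0 = t (fun i => s i.+1)).

Lemma dfn_iff k P Q : (forall s, P s <-> Q s) -> dfn k P -> dfn k Q.
Proof. by move=> PQ [phi [? ? H]]; exists phi; split=> // s; rewrite H. Qed.

Lemma dfn_not k P : dfn k P -> dfn k (fun s => ~ P s).
Proof. by case=> phi [? ? H]; exists (fNeg phi); split=> //= s; rewrite H. Qed.

Lemma dfn_and k P Q : dfn k P -> dfn k Q -> dfn k (fun s => P s /\ Q s).
Proof.
move=> [p [fp bp Hp]] [q [fq bq Hq]]; exists (fAnd p q).
by split=> /= [|//|s]; rewrite ?fp ?Hp ?Hq.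
Qed.

Lemma dfn_or k P Q : dfn k P -> dfn k Q -> dfn k (fun s => P s \/ Q s).
Proof.
move=> [p [fp bp Hp]] [q [fq bq Hq]]; exists (fOr p q).
by split=> /= [|//|s]; rewrite ?fp ?Hp ?Hq.
Qed.

Lemma dfn_imp k P Q : dfn k P -> dfn k Q -> dfn k (fun s => P s -> Q s).
Proof.
move=> dP dQ; apply: dfn_iff (dfn_or (dfn_not dP) dQ) => s.
by have := classic (P s); tauto.
Qed.

Lemma dfn_equiv k P Q : dfn k P -> dfn k Q -> dfn k (fun s => P s <-> Q s).
Proof. by move=> dP dQ; apply: dfn_and; apply: dfn_imp. Qed.

Lemma dfn_ex k (P : (nat -> A) -> A -> Prop) :
  dfn k.+1 (fun s => P (fun i => s i.+1) (s 0)) -> dfn k (fun s => exists a, P s a).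
Proof.
case=> phi [? ? H]; exists (fEx phi); split=> //= s.
have Hs a : sat (env_cons a s) phi <-> P s a := H (env_cons a s).
by split=> -[a Ha]; exists a; apply/Hs.
Qed.

Lemma dfn_all k (P : (nat -> A) -> A -> Prop) :
  dfn k.+1 (fun s => P (fun i => s i.+1) (s 0)) -> dfn k (fun s => forall a, P s a).
Proof.
case=> phi [? ? H]; exists (fAll phi); split=> //= s.
have Hs a : sat (env_cons a s) phi <-> P s a := H (env_cons a s).
by split=> Ha a; apply/Hs.
Qed.

Lemma dfn_ren k k' (r : nat -> nat) P : (forall i, i < k -> r i < k') ->
  dfn k P -> dfn k' (fun s => P (fun i => s (r i))).
Proof.
move=> rk [phi [fp bp H]]; exists (ren r phi); split=> [||s].
- by rewrite finitary_ren.
- exact: free_below_ren bp.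
- by rewrite sat_ren H.
Qed.

(** It is applied to the lists of operations and of atoms, which exist because the language adds
    only finitely many symbols. *)
Lemma dfn_allin k (I : Type) (l : seq I) (P : I -> (nat -> A) -> Prop) :
  (forall o, dfn k (P o)) -> dfn k (fun s => forall o, List.In o l -> P o s).
Proof.
move=> dP; elim: l => [|o l IH] /=.
  exists (fAll (fEq (tVar 0) (tVar 0))); split=> //= s; split=> // _ a.
apply: dfn_iff (dfn_and (dP o) IH) => s; split=> [[Po Pl] o' [<-//|]|H].
  exact: Pl.
by split=> [|o' lo']; apply: H; [left|right].
Qed.

Lemma dtm_var k j : j < k -> dtm k (fun s => s j).
Proof. by move=> jk; exists (fEq (tVar 0) (tVar j.+1)); split=> //=; rewrite jk. Qed.

Lemma dtm_weak k t : dtm k t -> dtm k.+1 (fun s => t (fun i => s i.+1)).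
Proof.
by move/(@dfn_ren _ k.+2 (fun i => if i is j.+1 then j.+2 else 0)); apply; case.
Qed.

(** [t] is known only through its graph, so substitution quantifies existentially over its value. *)
Lemma dfn_subst k P t : dfn k.+1 P -> dtm k t -> dfn k (fun s => P (env_cons (t s) s)).
Proof.
move=> dP dt; apply: (@dfn_iff _ (fun s => exists a, a = t s /\ P (env_cons a s))).
  by move=> s; split=> [[a [->]]|] //; exists (t s).
apply: dfn_ex; apply: dfn_and => //.
apply: dfn_iff dP => s.
by have -> : env_cons (s 0) (fun i => s i.+1) = s by apply: functional_extensionality; case.
Qed.

Lemma dfn_app1 k (Q : A -> Prop) t :
  dfn 1 (fun s => Q (s 0)) -> dtm k t -> dfn k (fun s => Q (t s)).
Proof.
move=> dQ dt; apply: (dfn_subst (P := fun s => Q (s 0))) dt.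
by apply: (@dfn_ren 1 k.+1 id) dQ; case.
Qed.

Lemma dfn_app2 k (Q : A -> A -> Prop) t u :
  dfn 2 (fun s => Q (s 0) (s 1)) -> dtm k t -> dtm k u ->
  dfn k (fun s => Q (t s) (u s)).
Proof.
move=> dQ dt du.
apply: (dfn_subst (P := fun s => Q (s 0) (u (fun i => s i.+1)))) dt.
apply: (dfn_subst (P := fun s => Q (s 1) (s 0))) (dtm_weak du).
by apply: (@dfn_ren 2 k.+2 (fun i => if i is 0 then 1 else 0)) dQ; case.
Qed.

Lemma dfn_app3 k (Q : A -> A -> A -> Prop) t u v :
  dfn 3 (fun s => Q (s 0) (s 1) (s 2)) -> dtm k t -> dtm k u -> dtm k v ->
  dfn k (fun s => Q (t s) (u s) (v s)).
Proof.
move=> dQ dt du dv.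
apply: (dfn_subst (P := fun s => Q (s 0) (u (fun i => s i.+1)) (v (fun i => s i.+1)))) dt.
apply: (dfn_subst (P := fun s => Q (s 1) (s 0) (v (fun i => s i.+2)))) (dtm_weak du).
apply: (dfn_subst (P := fun s => Q (s 2) (s 1) (s 0))) (dtm_weak (dtm_weak dv)).
by apply: (@dfn_ren 3 k.+3 (fun i => 2 - i)) dQ => -[|[|[|]]].
Qed.

Lemma dtm_app1 k (F : A -> A) t :
  dtm 1 (fun s => F (s 0)) -> dtm k t -> dtm k (fun s => F (t s)).
Proof.
move=> dF dt; apply: (dfn_app2 (Q := fun a b => a = F b)); first exact: dF.
  exact: dtm_var.
exact: dtm_weak dt.
Qed.

Lemma dtm_app2 k (F : A -> A -> A) t u :
  dtm 2 (fun s => F (s 0) (s 1)) -> dtm k t -> dtm k u ->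
  dtm k (fun s => F (t s) (u s)).
Proof.
move=> dF dt du; apply: (dfn_app3 (Q := fun a b c => a = F b c)); first exact: dF.
- exact: dtm_var.
- exact: dtm_weak dt.
- exact: dtm_weak du.
Qed.

Lemma dfn_eq k t u : dtm k t -> dtm k u -> dfn k (fun s => t s = u s).
Proof.
by apply: (dfn_app2 (Q := fun a b => a = b)); exists (fEq (tVar 0) (tVar 1)).
Qed.

Lemma dfn_lt k t u : dtm k t -> dtm k u -> dfn k (fun s => lt_of (t s) (u s)).
Proof. by apply: dfn_app2; exists (fLt (tVar 0) (tVar 1)). Qed.

Lemma dtm_zero k : dtm k (fun _ => zero_of A).
Proof. by exists (fEq (tVar 0) tZero). Qed.

Lemma dtm_one k : dtm k (fun _ => one_of A).
Proof. by exists (fEq (tVar 0) tOne). Qed.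

Lemma dtm_cst k c : dtm k (fun _ => cst_of A c).
Proof. by exists (fEq (tVar 0) (tCst c)). Qed.

Lemma dtm_add k t u : dtm k t -> dtm k u -> dtm k (fun s => add_of (t s) (u s)).
Proof. by apply: dtm_app2; exists (fEq (tVar 0) (tAdd (tVar 1) (tVar 2))). Qed.

Lemma dtm_mul k t u : dtm k t -> dtm k u -> dtm k (fun s => mul_of (t s) (u s)).
Proof. by apply: dtm_app2; exists (fEq (tVar 0) (tMul (tVar 1) (tVar 2))). Qed.

Lemma dfn_rel k (r : rel_sym L) (ts : 'I_(arity r) -> (nat -> A) -> A) :
  (forall j, dtm k (ts j)) -> dfn k (fun s => rel_of [tuple ts j s | j < arity r]).
Proof.
move=> dts.
(* The arguments are substituted one at a time, from the last to the first: in the claim for [n] the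
   first [n] are still variables. At [n = arity r] it is an atomic formula, at [n = 0] the goal. *)
suff H n : n <= arity r -> dfn (n + k) (fun s : nat -> A => rel_of
    [tuple (if j < n then s j else ts j (fun i => s (n + i))) | j < arity r]).
  by apply: dfn_iff (H 0 isT) => s.
move=> le_n; rewrite -(subKn le_n); elim: (arity r - n) (leq_subr n (arity r)) => [_|m IH].
  rewrite subn0; exists (fRel [tuple tVar (j : nat) | j < arity r]); split=> [//||s].
    apply/all_tnthP => j; rewrite tnth_mktuple /=.
    exact: leq_trans (ltn_ord j) (leq_addr _ _).
  suff /= -> : map_tuple (eval s) [tuple tVar (j : nat) | j < arity r] =
    [tuple (if j < arity r then s j else ts j (fun i => s (arity r + i))) | j < arity r] by [].
  by apply: eq_from_tnth => j; rewrite tnth_map !tnth_mktuple /= ltn_ord.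
move=> lt_m; have {IH} := IH (ltnW lt_m).
have -> : arity r - m = (arity r - m.+1).+1 by rewrite subnSK.
set p := arity r - m.+1.
have lt_p : p < arity r by rewrite /p subnSK // leq_subr.
have [j0 j0p dj0] : exists2 j0 : 'I_(arity r), j0 = p :> nat & dtm k (ts j0).
  by exists (Ordinal lt_p).
move=> IH.
have dj0' : dtm (p + k) (fun s => ts j0 (fun i => s (p + i))).
  have := @dfn_ren _ (p + k).+1 (fun i => if i is j.+1 then (p + j).+1 else 0) _ _ dj0.
  by apply; case=> //= i; rewrite !ltnS ltn_add2l.
(* [dfn_subst] puts the new value at index 0, so [rho] moves slot [p] to the front and shifts the
   slots below it by one. *)
pose rho i := if i == p then 0 else if i < p then i.+1 else i.
have {}IH : dfn (p + k).+1 (fun s : nat -> A => rel_of [tuple (if j < p.+1 then s (rho j)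
     else ts j (fun i => s (rho (p.+1 + i)))) | j < arity r]).
  apply: (@dfn_ren _ _ rho) IH => i; rewrite /rho addSn; case: eqP => // _.
  by case: (ltnP i p) => // ip _; rewrite ltnS (leq_trans ip) ?leq_addr.
apply: dfn_iff (dfn_subst IH dj0') => s.
set T1 := (X in rel_of X <-> _); set T2 := (X in _ <-> rel_of X).
suff -> : T1 = T2 by [].
apply: eq_from_tnth => j; rewrite !tnth_mktuple /rho ltnS leq_eqVlt.
case: (ltngtP (j : nat) p) => [lt_jp|lt_pj|eq_jp] //=.
- congr ts; apply: functional_extensionality => i.
  have lt_pi : p < p.+1 + i by rewrite addSn ltnS leq_addr.
  by rewrite (gtn_eqF lt_pi) ltnNge (ltnW lt_pi).
- by have -> : j = j0 by apply: val_inj; rewrite /= eq_jp j0p.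
Qed.

End Definability.

(** * Choice, and the order on ordinal trees *)

Lemma fchoice (T U : Type) (R : T -> U -> Prop) :
  (forall x, exists y, R x y) -> exists f, forall x, R x (f x).
Proof.
move=> H; exists (fun x => proj1_sig (constructive_indefinite_description _ (H x))).
by move=> x; exact: proj2_sig (constructive_indefinite_description _ (H x)).
Qed.

Lemma In_tnth (T : Type) n (t : n.-tuple T) (j : 'I_n) : List.In (tnth t j) t.
Proof.
rewrite (tnth_nth (tnth t j)); have : j < size t by rewrite size_tuple.
move: (tnth t j) (j : nat) => x {}j; elim: (tval t) j => // y l IH [|j] /=; first by left.
by right; apply: IH.
Qed.

Lemma ole_refl a : ole a a.
Proof. by elim: a => X f IH /= i; exists i; apply: IH. Qed.

Lemma ole_trans a b c : ole a b -> ole b c -> ole a c.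
Proof.
elim: a b c => X f IH [Y g] [Z h] /= fg gh i.
have [j /IH ij] := fg i; have [k /ij ik] := gh j; by exists k.
Qed.

Lemma ole_olt a b : ole a b \/ olt b a.
Proof.
elim: a b => X f IH [Y g].
case: (classic (forall i, exists j, ole (f i) (g j))) => [|H]; first by left.
right; have [i Hi] := not_all_ex_not _ _ H; exists i.
suff Hj j : olt (g j) (f i) by move: Hj; case: (f i).
by have [|//] := IH i (g j); move=> ij; case: Hi; exists j.
Qed.

Lemma olt_ole a b : olt a b -> ole a b.
Proof.
elim: a b => X f IH [Y g] [j]; case E: (g j) => [Z h] fh i.
by exists j; apply: IH; rewrite E; apply: fh.
Qed.

(** The induction is on a tree [a] bounding a witness [a']: a witness that is not least has another
    strictly below it, and that one is bounded by an immediate subtree of [a]. *)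
Lemma ole_least (P : ordinal_tree -> Prop) a0 :
  P a0 -> exists2 a, P a & forall b, P b -> ole a b.
Proof.
suff H a a' : P a' -> ole a' a -> exists2 a, P a & forall b, P b -> ole a b.
  by move=> Pa0; apply: H Pa0 (ole_refl a0).
elim: a a' => X f IH a' Pa' le_a'.
case: (classic (forall b, P b -> ole a' b)) => [?|H]; first by exists a'.
have [b Hb] := not_all_ex_not _ _ H; have [Pb nle] := imply_to_and _ _ Hb.
have [//|lt_ba] := ole_olt a' b.
case: a' le_a' lt_ba {Pa' nle H Hb} => Y g gf [j bj]; have [i ji] := gf j.
exact: IH Pb (ole_trans bj ji).
Qed.

(** * Prenex normal form of infinitary formulas *)

Section NormalForm.

Variable L : language.
Implicit Types (p q : formula L) (f : nat -> formula L).

(** For free variables one direction is enough: closedness only has to pass from a sentence to its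
    normal form. *)
Definition eqv p q : Prop := (forall n, free_below n p -> free_below n q) /\
  forall (A : structure L) (s : nat -> A), sat s p <-> sat s q.

Lemma eqv_trans p q r : eqv p q -> eqv q r -> eqv p r.
Proof. by move=> [f e] [f' e']; split=> [n /f /f'|A s] //; rewrite e e'. Qed.

Lemma eqv_neg p q : eqv p q -> eqv (fNeg p) (fNeg q).
Proof. by move=> [f e]; split=> //= A s; rewrite e. Qed.

Lemma free_below_fExs n k p : free_below n (fExs k p) <-> free_below (k + n) p.
Proof. by elim: k n => //= k IH n; rewrite IH addnS. Qed.

Lemma free_below_fAlls n k p : free_below n (fAlls k p) <-> free_below (k + n) p.
Proof. by elim: k n => //= k IH n; rewrite IH addnS. Qed.

Lemma sat_fExs_eq (A : structure L) k p q (s : nat -> A) :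
  (forall s : nat -> A, sat s p <-> sat s q) -> sat s (fExs k p) <-> sat s (fExs k q).
Proof. by move=> pq; elim: k s => //= k IH s; split=> -[a /IH]; exists a. Qed.

Lemma sat_fAlls_neg (A : structure L) k p (s : nat -> A) :
  sat s (fAlls k (fNeg p)) <-> ~ sat s (fExs k p).
Proof.
elim: k s => //= k IH s; split=> [H [a]|H a]; first exact/IH.
by apply/IH => Ha; apply: H; exists a.
Qed.

Lemma sat_fAlls_eq (A : structure L) k p q (s : nat -> A) :
  (forall s : nat -> A, sat s p <-> sat s q) -> sat s (fAlls k p) <-> sat s (fAlls k q).
Proof. by move=> pq; elim: k s => //= k IH s; split=> H a; apply/IH. Qed.

(** Carrying both kinds of normal form for [p] and for its negation, all at one level, lets the
    induction pass a negation by exchanging them. *)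
Definition normalizable p : Prop := exists a ps pp ns np,
  [/\ Sigma_in a ps, Pi_in a pp, Sigma_in a ns & Pi_in a np] /\
  [/\ eqv p ps, eqv p pp, eqv (fNeg p) ns & eqv (fNeg p) np].

Lemma normalizable_eqv p q : eqv p q -> normalizable q -> normalizable p.
Proof.
move=> pq [a [ps [pp [ns [np [? [e1 e2 e3 e4]]]]]]].
exists a, ps, pp, ns, np; split=> //; have npq := eqv_neg pq.
by split; [apply: eqv_trans e1|apply: eqv_trans e2|apply: eqv_trans e3|apply: eqv_trans e4].
Qed.

Lemma eqv_negneg p : eqv (fNeg (fNeg p)) p.
Proof. by split=> //= A s; split=> [/NNPP|]; tauto. Qed.

Lemma normalizable_neg p : normalizable p -> normalizable (fNeg p).
Proof.
move=> [a [ps [pp [ns [np [[? ? ? ?] [e1 e2 e3 e4]]]]]]].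
exists a, ns, np, ps, pp; split; split=> //; exact: eqv_trans (eqv_negneg p) _.
Qed.

(** Pi forms of the [f i] give a Sigma form of the disjunction, and Sigma forms of their negations a
    Pi form of its negation, both at the supremum [b]. The two missing forms come from a trivial
    connective one level up. *)
Lemma normalizable_or f k : (forall i, normalizable (f i)) ->
  normalizable (fBigOr (fun i => fExs (k i) (f i))).
Proof.
move=> /fchoice [a /fchoice [ps /fchoice [pp /fchoice [ns /fchoice [np H]]]]].
pose b := osup a.
have lt_ab i : olt (a i) b by exists i; apply: ole_refl.
have lt_absb i : olt (a i) (osucc b) by exists tt; apply/olt_ole.
have lt_b : olt b (osucc b) by exists tt; apply: ole_refl.
pose P := fBigOr (fun i => fExs (k i) (pp i)).
pose N := fBigAnd (fun i => fAlls (k i) (ns i)).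
have P_b : Sigma_in b P by apply: Sigma_in_pos lt_ab _ => i; case: (H i) => -[].
have N_b : Pi_in b N by apply: Pi_in_pos lt_ab _ => i; case: (H i) => -[].
have eP : eqv (fBigOr (fun i => fExs (k i) (f i))) P.
  split=> [n H' i|A s].
    apply/free_below_fExs; case: (H i) => _ [_ [fb _] _ _]; apply: fb.
    exact/free_below_fExs.
  have E i : sat s (fExs (k i) (f i)) <-> sat s (fExs (k i) (pp i)).
    by apply: sat_fExs_eq => s'; case: (H i) => _ [_ [_ ->] _ _].
  by split=> -[i Hi]; exists i; apply/E.
have eN : eqv (fNeg (fBigOr (fun i => fExs (k i) (f i)))) N.
  split=> [n H' i|A s].
    apply/free_below_fAlls; case: (H i) => _ [_ _ [fb _] _]; apply: fb.
    by have /free_below_fExs := H' i.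
  have E i : sat s (fAlls (k i) (ns i)) <-> ~ sat s (fExs (k i) (f i)).
    rewrite -sat_fAlls_neg; apply: sat_fAlls_eq => s'.
    by case: (H i) => _ [_ _ [_ <-] _].
  split=> [H' i|H' [i Hi]]; first by apply/E => Hi; apply: H'; exists i.
  by have /E := H' i.
have wrap_or q : eqv q (fBigOr (fun _ => fExs 0 q)).
  by split=> [n ? _ //|A s]; split=> [|[]]; [exists 0|].
have wrap_and q : eqv q (fBigAnd (fun _ => fAlls 0 q)).
  by split=> [n ? _ //|A s]; split=> [? _ //|]; apply; apply: 0.
exists (osucc b), P, (fBigAnd (fun _ => fAlls 0 P)), (fBigOr (fun _ => fExs 0 N)), N.
split; split=> //.
- by apply: Sigma_in_pos lt_absb _ => i; case: (H i) => -[].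
- exact: (@Pi_in_pos _ _ (fun=> b) (fun=> 0)).
- exact: (@Sigma_in_pos _ _ (fun=> b) (fun=> 0)).
- by apply: Pi_in_pos lt_absb _ => i; case: (H i) => -[].
- exact: eqv_trans eP (wrap_and P).
- exact: eqv_trans eN (wrap_or N).
Qed.

Lemma normalizable_qf p : finitary p -> quantifier_free p -> normalizable p.
Proof.
move=> fp qp; have le0 := ole_refl ozero.
exists ozero, p, p, (fNeg p), (fNeg p); split; split=> //.
all: by [apply: Sigma_in_zero | apply: Pi_in_zero].
Qed.

(** All connectives reduce to negation and countable disjunctions of existential blocks. *)
Lemma normalizable_all p : normalizable p.
Proof.
elim: p => [t u|t u|r ts|p Np|p Np q Nq|p Np q Nq|p Np|p Np|f Nf|f Nf].
- exact: normalizable_qf.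
- exact: normalizable_qf.
- exact: normalizable_qf.
- exact: normalizable_neg.
- apply: (@normalizable_eqv _ (fNeg (fOr (fNeg p) (fNeg q)))).
    by split=> //= A s; split; [tauto|move/not_or_and=> [/NNPP ? /NNPP]].
  apply: normalizable_neg.
  apply: (@normalizable_eqv _
    (fBigOr (fun i => fExs 0 (if i is 0 then fNeg p else fNeg q)))).
    split=> [n /= [? ?] [|i] //|A s /=].
    by split=> [[?|?]|[[|i] ?]]; [exists 0|exists 1|left|right].
  by apply: normalizable_or => -[|i]; apply: normalizable_neg.
- apply: (@normalizable_eqv _ (fBigOr (fun i => fExs 0 (if i is 0 then p else q)))).
    split=> [n /= [? ?] [|i] //|A s /=].
    by split=> [[?|?]|[[|i] ?]]; [exists 0|exists 1|left|right].
  by apply: normalizable_or => -[|i].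
- apply: (@normalizable_eqv _ (fBigOr (fun i => fExs 1 p))).
    by split=> [n ? _ //|A s /=]; split=> [|[_ //]]; exists 0.
  exact: normalizable_or.
- apply: (@normalizable_eqv _ (fNeg (fBigOr (fun i => fExs 1 (fNeg p))))).
    split=> [n ? _ //|A s /=]; split=> [H [_ [a]] //|H a]; apply: NNPP => Na.
    by apply: H; exists 0, a.
  by apply/normalizable_neg/normalizable_or => i; apply: normalizable_neg.
- apply: (@normalizable_eqv _ (fNeg (fBigOr (fun i => fExs 0 (fNeg (f i)))))).
    split=> [n ? //|A s /=]; split=> [H [i] //|H i]; apply: NNPP => Na.
    by apply: H; exists i.
  by apply/normalizable_neg/normalizable_or => i; apply: normalizable_neg.
- exact: (@normalizable_or f (fun=> 0)).
Qed.

Lemma Pi_normal_form p : exists a q, Pi_in (osucc a) q /\ eqv p q.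
Proof.
have [a [ps [_ [_ [_ [[Sps _ _ _] [e _ _ _]]]]]]] := normalizable_all p.
exists a, (fBigAnd (fun _ => fAlls 0 ps)); split.
  by apply: (@Pi_in_pos _ _ (fun=> a) (fun=> 0)) => // i; exists tt; apply: ole_refl.
apply: eqv_trans e _; split=> [n ? _ //|A s].
by split=> [? _ //|]; apply; apply: 0.
Qed.

End NormalForm.

(** * Existence of Scott sentences *)

Lemma countable_enum L (A : structure L) : countable_structure A ->
  exists e : nat -> A, forall a, exists n, e n = a.
Proof.
case=> f f_inj.
have /fchoice [e He] : forall n, exists a : A, (exists a', f a' = n) -> f a = n.
  move=> n; case: (classic (exists a', f a' = n)) => [[a ?]|?]; first by exists a.
  by exists (zero_of A).
by exists e => a; exists (f a); apply: f_inj; apply: He; exists a.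
Qed.

Definition envs L (A : structure L) (w : seq A) : nat -> A :=
  foldr (@env_cons A) (fun=> zero_of A) w.

Lemma envs_nth L (A : structure L) (w : seq A) i : envs w i = nth (zero_of A) w i.
Proof. by elim: w i => [|a w IH] [|i] //=. Qed.

Lemma sat_fAlls_envs L (A : structure L) (w : seq A) p :
  sat (@envs L A [::]) (fAlls (size w) p) -> sat (envs w) p.
Proof.
elim: w p => // a w IH p; rewrite /fAlls [size _]/= iterSr => /IH; exact.
Qed.

Lemma sat_fAlls_valid L (A : structure L) k p (s : nat -> A) :
  (forall s : nat -> A, sat s p) -> sat s (fAlls k p).
Proof. by move=> Hp; elim: k s => //= k IH s a. Qed.

Lemma isomorphic_refl L (A : structure L) : isomorphic A A.
Proof.
exists id; do !split=> //; first by exists id.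
all: by rewrite (_ : map_tuple id t = t) //; apply: eq_from_tnth => i; rewrite tnth_map.
Qed.

Section ScottSentence.

Variables (L : language) (M : structure L) (e : nat -> M).
Hypothesis e_surj : forall a, exists n, e n = a.

Definition fTrue : formula L := fEq tZero tZero.

Definition nat_list n : seq nat := odflt [::] (unpickle n).
Definition tup n : seq M := map e (nat_list n).

Lemma tup_surj w : exists n, tup n = w.
Proof.
suff [l <-] : exists l, map e l = w by exists (pickle l); rewrite /tup /nat_list pickleK.
elim: w => [|a w [l <-]]; first by exists [::].
by have [n <-] := e_surj a; exists (n :: l).
Qed.

(** If some formula holds of [w] and fails of [v], one is chosen; otherwise any true formula serves.
    One formula per pair of tuples then expresses a whole infinitary type, since there are countably
    many tuples. *)
Lemma separators : exists sep : seq M -> seq M -> formula L, forall w v,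
  [/\ free_below (size w) (sep w v), sat (envs w) (sep w v) &
      forall p, free_below (size w) p -> sat (envs v) (sep w v) ->
        sat (envs w) p -> sat (envs v) p].
Proof.
suff /fchoice [g Hg] (wv : seq M * seq M) : exists q : formula L,
    [/\ free_below (size wv.1) q, sat (envs wv.1) q & forall p,
    free_below (size wv.1) p -> sat (envs wv.2) q -> sat (envs wv.1) p -> sat (envs wv.2) p].
  by exists (fun w v => g (w, v)) => w v; have := Hg (w, v).
case: wv => w v /=.
case: (classic (exists q, [/\ free_below (size w) q, sat (envs w) q & ~ sat (envs v) q])).
  by case=> q [? ? ?]; exists q; split.
by move=> H; exists fTrue; split=> // p fp _ wp; apply: NNPP => ?; apply: H; exists p.
Qed.

(** Countable codes of unnested literals, which suffice to describe an isomorphism. The boolean is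
    the sign; tags 0 to 4 stand for zero, one, sum, product and order, any other tag for
    equality. *)
Definition literal_code : Type :=
  (bool * (nat * (nat * nat * nat) + {r : rel_sym L & (arity r).-tuple nat} +
    (cst_sym L * nat)))%type.

Definition literal (c : literal_code) : formula L :=
  let: (b, d) := c in
  let p := match d with
    | inl (inl (0, (i, _, _))) => fEq (tVar i) tZero
    | inl (inl (1, (i, _, _))) => fEq (tVar i) tOne
    | inl (inl (2, (i, j, k))) => fEq (tAdd (tVar i) (tVar j)) (tVar k)
    | inl (inl (3, (i, j, k))) => fEq (tMul (tVar i) (tVar j)) (tVar k)
    | inl (inl (4, (i, j, _))) => fLt (tVar i) (tVar j)
    | inl (inl (_, (i, j, _))) => fEq (tVar i) (tVar j)
    | inl (inr (existT r t)) => fRel (map_tuple (@tVar L) t)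
    | inr (c, i) => fEq (tVar i) (tCst c)
    end in if b then p else fNeg p.

Definition diag_lit (w : seq M) (n : nat) : formula L :=
  if unpickle n is Some c then
    if excluded_middle_informative
      (free_below (size w) (literal c) /\ sat (envs w) (literal c))
    then literal c else fTrue
  else fTrue.

Definition diag w : formula L := fBigAnd (diag_lit w).

Lemma diagP (B : structure L) (s : nat -> B) w c : sat s (diag w) ->
  free_below (size w) (literal c) -> sat (envs w) (literal c) -> sat s (literal c).
Proof.
move=> /(_ (pickle c)); rewrite /diag_lit (pickleK c).
by case: excluded_middle_informative => // H _ ? ?; case: H.
Qed.

Lemma diag_free w : free_below (size w) (diag w).
Proof.
move=> n; rewrite /diag_lit; case: unpickle => //= c.
by case: excluded_middle_informative => // -[].
Qed.

Lemma diag_sat w : sat (envs w) (diag w).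
Proof.
move=> n; rewrite /diag_lit; case: unpickle => //= c.
by case: excluded_middle_informative => // -[].
Qed.

Variable sep : seq M -> seq M -> formula L.
Hypothesis sepP : forall w v,
  [/\ free_below (size w) (sep w v), sat (envs w) (sep w v) &
      forall p, free_below (size w) p -> sat (envs v) (sep w v) ->
        sat (envs w) p -> sat (envs v) p].

(* Defines, within [M], the tuples with the same L_{omega_1,omega}-type as [w]. *)
Definition type_of w : formula L := fBigAnd (fun n => sep w (tup n)).

Lemma type_of_free w : free_below (size w) (type_of w).
Proof. by move=> n; case: (sepP w (tup n)). Qed.

Lemma type_of_sat w : sat (envs w) (type_of w).
Proof. by move=> n; case: (sepP w (tup n)). Qed.

Lemma type_ofP w p (s : nat -> M) : free_below (size w) p ->
  sat s (type_of w) -> sat (envs w) p -> sat s p.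
Proof.
move=> fp; pose v := mkseq s (size w).
have vs i : i < size w -> envs v i = s i.
  by move=> iw; rewrite envs_nth nth_mkseq.
move/(sat_free (type_of_free w) vs) => H wp.
apply/(sat_free fp vs).
have [n vn] := tup_surj v; have [_ _] := sepP w (tup n).
by rewrite vn; apply=> //; have := H n; rewrite vn.
Qed.

(** What the back-and-forth construction asks of a tuple: forth, back, and the atomic diagram. *)
Definition extension w : formula L :=
  fAnd (fBigAnd (fun n => fEx (type_of (e n :: w))))
    (fAnd (fAll (fBigOr (fun n => type_of (e n :: w)))) (diag w)).

Lemma extension_free w : free_below (size w) (extension w).
Proof.
split; first by move=> n; apply: (type_of_free (e n :: w)).
by split; [move=> n; apply: (type_of_free (e n :: w))|apply: diag_free].
Qed.

Lemma extension_sat w : sat (envs w) (extension w).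
Proof.
split; first by move=> n; exists (e n); apply: (type_of_sat (e n :: w)).
split; last exact: diag_sat.
by move=> a; have [n <-] := e_surj a; exists n; apply: (type_of_sat (e n :: w)).
Qed.

Definition scott : formula L := fAnd (type_of [::])
  (fBigAnd (fun n => fAlls (size (tup n))
     (fOr (fNeg (type_of (tup n))) (extension (tup n))))).

Lemma scott_free : free_below 0 scott.
Proof.
split; first exact: (type_of_free [::]).
move=> n; apply/free_below_fAlls; rewrite addn0.
by split; [apply: (type_of_free (tup n))|apply: extension_free].
Qed.

Lemma models_scott : models M scott.
Proof.
move=> s; split.
  by apply/(@sat_free _ M _ 0 _ (envs [::]) (type_of_free [::])) => //; apply: type_of_sat.
move=> n; apply: sat_fAlls_valid => {}s /=.
case: (classic (sat s (type_of (tup n)))) => H; last by left.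
right; exact: type_ofP (extension_free _) H (extension_sat _).
Qed.

(** * The isomorphism onto a countable model of the Scott sentence *)

Section BackAndForth.

Variables (B : structure L) (e' : nat -> B).
Hypothesis e'_surj : forall b, exists n, e' n = b.
Hypothesis scottB : models B scott.

Implicit Type z : seq (M * B).

Definition good z : Prop := sat (envs (unzip2 z)) (type_of (unzip1 z)).

Lemma good_nil : good [::].
Proof. by have [] := scottB (envs [::]). Qed.

Lemma good_extension z : good z -> sat (envs (unzip2 z)) (extension (unzip1 z)).
Proof.
move=> gz; have [_ H] := scottB (envs [::]).
have [n zn] := tup_surj (unzip1 z).
have := H n; rewrite zn size_map -(size_map snd z) => /sat_fAlls_envs [] //.
Qed.

Lemma good_forth z a : good z -> exists b, good ((a, b) :: z).
Proof.
move=> /good_extension [H _]; have [n <-] := e_surj a.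
by have [b Hb] := H n; exists b.
Qed.

Lemma good_back z b : good z -> exists a, good ((a, b) :: z).
Proof. by move=> /good_extension [_ [/(_ b) [n Hn] _]]; exists (e n). Qed.

Lemma good_literal z c : good z -> free_below (size z) (literal c) ->
  sat (envs (unzip1 z)) (literal c) -> sat (envs (unzip2 z)) (literal c).
Proof.
move=> /good_extension [_ [_ D]] fc; apply: diagP D _.
by rewrite size_map.
Qed.

Lemma good_sequence : exists G : nat -> seq (M * B),
  [/\ forall n, good (G n),
      forall n m x, n <= m -> List.In x (G n) -> List.In x (G m),
      forall a, exists n b, List.In (a, b) (G n) &
      forall b, exists n a, List.In (a, b) (G n)].
Proof.
have /fchoice [step Hstep] : forall nz : nat * seq (M * B), exists z', good nz.2 ->
    [/\ good z', forall x, List.In x nz.2 -> List.In x z',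
        exists b, List.In (e nz.1, b) z' & exists a, List.In (a, e' nz.1) z'].
  move=> [n z] /=; case: (classic (good z)) => [gz|]; last by exists [::].
  have [b /[dup] gb /(good_back (e' n)) [a ga]] := good_forth (e n) gz.
  exists [:: (a, e' n), (e n, b) & z] => _; split=> //.
  - by move=> x xz; right; right.
  - by exists b; right; left.
  - by exists a; left.
pose G := fix G n := if n is m.+1 then step (m, G m) else [::].
have gG n : good (G n).
  by elim: n => [|n IH]; [apply: good_nil | have [] := Hstep (n, G n) IH].
exists G; split=> //.
- move=> n m x nm xn; elim: m nm => [|m IH]; first by case: n xn.
  rewrite leq_eqVlt => /orP [/eqP <- //|/IH xm].
  by have [_ H _ _] := Hstep (m, G m) (gG m); apply: H.
- move=> a; have [n <-] := e_surj a; exists n.+1.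
  by have [] := Hstep (n, G n) (gG n).
- move=> b; have [n <-] := e'_surj b; exists n.+1.
  by have [] := Hstep (n, G n) (gG n).
Qed.

Lemma In_nth z x : List.In x z -> exists2 i, i < size z &
  envs (unzip1 z) i = x.1 /\ envs (unzip2 z) i = x.2.
Proof.
elim: z => //= y z IH [->|/IH [i iz Hi]]; first by exists 0.
by exists i.+1.
Qed.

(** The union [H] of the stages is a bijection because the equality literal and its negation are
    preserved; the other literals make it an isomorphism. *)
Lemma back_and_forth : isomorphic M B.
Proof.
have [G [gG G_mono G_dom G_cod]] := good_sequence.
pose H a b := exists n, List.In (a, b) (G n).
have /fchoice [h Hh] : forall a, exists b, H a b.
  by move=> a; have [n [b ?]] := G_dom a; exists b, n.
have pull (l : seq (M * B)) : (forall x, List.In x l -> H x.1 x.2) ->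
    exists n, forall x, List.In x l -> List.In x (G n).
  elim: l => [|x l IH] Hl; first by exists 0.
  have [|n Hn] := IH; first by move=> y yl; apply: Hl; right.
  have [|m Hm] := Hl x; first by left.
  exists (maxn n m) => y [<-|/Hn]; last exact/G_mono/leq_maxl.
  by apply: G_mono (leq_maxr n m) _; case: x Hm {Hl}.
have Heq a b a' b' : H a b -> H a' b' -> (a = a' <-> b = b').
  move=> Hab Hab'; have [|n Hn] := pull [:: (a, b); (a', b')].
    by move=> x /= [<-|[<-|]].
  have [|i iG [/= Ei1 Ei2]] := @In_nth (G n) (a, b); first by apply: Hn; left.
  have [|j jG [/= Ej1 Ej2]] := @In_nth (G n) (a', b').
    by apply: Hn; right; left.
  have L1 := @good_literal _ (true, inl (inl (5, (i, j, 0)))) (gG n).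
  have L2 := @good_literal _ (false, inl (inl (5, (i, j, 0)))) (gG n).
  move: L1 L2; rewrite /= Ei1 Ei2 Ej1 Ej2 iG jG => L1 L2.
  by split=> [/L1|bb']; [exact|apply: NNPP => /(L2 isT)].
have Hfun a b : H a b <-> h a = b.
  split=> [Hab|<-//]; by apply/(Heq _ _ _ _ (Hh a) Hab).
have /fchoice [g Hg] : forall b, exists a, h a = b.
  by move=> b; have [n [a ?]] := G_cod b; exists a; apply/Hfun; exists n.
have h_inj a a' : h a = h a' -> a = a'.
  by move/(Heq _ _ _ _ (Hh a) (Hh a')).
(* Finitely many elements get variables at a common stage, so that one literal can speak of all of
   them. *)
have ind (l : seq M) : exists n (idx : M -> nat), forall a, List.In a l -> 
    [/\ idx a < size (G n), envs (unzip1 (G n)) (idx a) = a &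
        envs (unzip2 (G n)) (idx a) = h a].
  have [|n Hn] := pull [seq (a, h a) | a <- l].
    by move=> x /List.in_map_iff [a [<- _]]; apply: Hh.
  have /fchoice [idx Hidx] : forall a, exists i, List.In a l ->
    [/\ i < size (G n), envs (unzip1 (G n)) i = a & envs (unzip2 (G n)) i = h a].
    move=> a; case: (classic (List.In a l)) => al; last by exists 0.
    have [|i iG [E1 E2]] := @In_nth (G n) (a, h a).
      by apply: Hn; apply/List.in_map_iff; exists a.
    by exists i.
  by exists n, idx.
have lit n c := @good_literal (G n) c (gG n).
exists h; split; [|split; [|split; [|split; [|split; [|split; [|split]]]]]].
- by exists g => a //; apply: h_inj.
- have [n [idx /(_ (zero_of M)) [|i1 E1 E2]]] := ind [:: zero_of M]; first by left.
  have := lit n (true, inl (inl (0, (idx (zero_of M), 0, 0)))).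
  by rewrite /= E1 E2 i1; apply.
- have [n [idx /(_ (one_of M)) [|i1 E1 E2]]] := ind [:: one_of M]; first by left.
  have := lit n (true, inl (inl (1, (idx (one_of M), 0, 0)))).
  by rewrite /= E1 E2 i1; apply.
- move=> x y; have [n [idx Hi]] := ind [:: x; y; add_of x y].
  have [|i1 E1 E1'] := Hi x; first by left.
  have [|i2 E2 E2'] := Hi y; first by right; left.
  have [|i3 E3 E3'] := Hi (add_of x y); first by right; right; left.
  have := lit n (true, inl (inl (2, (idx x, idx y, idx (add_of x y))))).
  by rewrite /= E1 E2 E3 E1' E2' E3' i1 i2 i3 => /(_ isT erefl) ->.
- move=> x y; have [n [idx Hi]] := ind [:: x; y; mul_of x y].
  have [|i1 E1 E1'] := Hi x; first by left.
  have [|i2 E2 E2'] := Hi y; first by right; left.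
  have [|i3 E3 E3'] := Hi (mul_of x y); first by right; right; left.
  have := lit n (true, inl (inl (3, (idx x, idx y, idx (mul_of x y))))).
  by rewrite /= E1 E2 E3 E1' E2' E3' i1 i2 i3 => /(_ isT erefl) ->.
- move=> x y; have [n [idx Hi]] := ind [:: x; y].
  have [|i1 E1 E1'] := Hi x; first by left.
  have [|i2 E2 E2'] := Hi y; first by right; left.
  have := lit n (true, inl (inl (4, (idx x, idx y, 0)))).
  have := lit n (false, inl (inl (4, (idx x, idx y, 0)))).
  rewrite /= E1 E2 E1' E2' i1 i2 => /(_ isT) L1 /(_ isT) L2.
  by split=> // hxy; apply: NNPP => /L1.
- move=> r t; have [n [idx Hi]] := ind t.
  have {}Hi (j : 'I_(arity r)) := Hi (tnth t j).
  have {}Hi j := Hi j (In_tnth t j).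
  pose u := map_tuple idx t.
  have fu : all (term_below (size (G n))) (map_tuple (@tVar L) u).
    by apply/all_tnthP => j; rewrite !tnth_map; case: (Hi j).
  have E1 : map_tuple (eval (envs (unzip1 (G n)))) (map_tuple (@tVar L) u) = t.
    by apply: eq_from_tnth => j; rewrite !tnth_map; case: (Hi j).
  have E2 : map_tuple (eval (envs (unzip2 (G n)))) (map_tuple (@tVar L) u) = map_tuple h t.
    by apply: eq_from_tnth => j; rewrite !tnth_map; case: (Hi j).
  have := lit n (true, inl (inr (existT _ r u))).
  have := lit n (false, inl (inr (existT _ r u))).
  rewrite /literal /free_below /sat E1 E2 => /(_ fu) L1 /(_ fu) L2.
  by split=> // ht; apply: NNPP => /L1.
- move=> c; have [n [idx /(_ (cst_of M c)) [|i1 E1 E2]]] := ind [:: cst_of M c]; first by left.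
  have := lit n (true, inr (c, idx (cst_of M c))).
  by rewrite /= E1 E2 i1; apply.
Qed.

End BackAndForth.

End ScottSentence.

Lemma scott_sentence_exists L (M : structure L) : countable_structure M ->
  exists p, scott_sentence M p.
Proof.
move=> cM; have [e e_surj] := countable_enum cM.
have [sep sepP] := separators M.
have scM := models_scott e_surj sepP.
exists (scott e sep); split; first exact: scott_free sepP.
move=> B cB; split=> [scB|[h hiso] s].
  have [e' e'_surj] := countable_enum cB.
  exact (back_and_forth e_surj e'_surj scB).
have [[g hK gK] _] := hiso.
have -> : s = h \o (g \o s) by apply: functional_extensionality => i /=; rewrite gK.
by apply/(sat_iso _ _ hiso); apply: scM.
Qed.

Lemma Pi_scott_sentence_exists L (M : structure L) : countable_structure M ->
  exists a, has_Pi_scott_sentence M (osucc a).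
Proof.
move=> /scott_sentence_exists [p [p0 pM]].
have [a [q [Pq [fq eq]]]] := Pi_normal_form p.
exists a, q; split=> //; split; first exact: fq.
move=> B /pM <-; split=> H s; exact/eq.
Qed.

(** * Back-and-forth relations on codes of tuples *)

Section Pairing.

Variables (L : language) (A : structure L).

(** A polynomial pairing, injective in models of PA. Being a term of the language, it keeps its
    meaning in the generic model built later. *)
Definition pr (x y : A) : A := add_of (mul_of (add_of x y) (add_of x y)) x.

Variables p1 p2 : A -> A.
Hypothesis p1_pr : forall x y, p1 (pr x y) = x.
Hypothesis p2_pr : forall x y, p2 (pr x y) = y.

(** Every element is read as an infinite list, with head [p1] and tail [p2], hence as an
    environment. *)
Definition dec (x : A) : nat -> A := fun i => p1 (iter i p2 x).

Lemma dec_pr a x : dec (pr a x) = env_cons a (dec x).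
Proof.
by apply: functional_extensionality => -[|i]; rewrite /dec ?iterSr /= ?p1_pr ?p2_pr.
Qed.

(** Pushes the first [k] entries of the list coded by [u] onto [x], so that a block of [k]
    quantifiers becomes a single quantifier over [u]. *)
Fixpoint ext k (u x : A) : A :=
  if k is k'.+1 then ext k' (p2 u) (pr (p1 u) x) else x.

Lemma sat_fExs_dec k p x :
  sat (dec x) (fExs k p) <-> exists u, sat (dec (ext k u x)) p.
Proof.
elim: k x => [|k IH] x /=; first by split=> [|[_ //]]; exists x.
split=> [[a]|[u Hu]].
  by rewrite -dec_pr IH => -[u Hu]; exists (pr a u); rewrite p1_pr p2_pr.
by exists (p1 u); rewrite -dec_pr IH; exists (p2 u).
Qed.

Lemma sat_fAlls_dec k p x :
  sat (dec x) (fAlls k p) <-> forall u, sat (dec (ext k u x)) p.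
Proof.
elim: k x => [|k IH] x /=; first by split=> // /(_ x).
split=> [H u|H a]; first by have := H (p1 u); rewrite -dec_pr IH.
by rewrite -dec_pr IH => u; have := H (pr a u); rewrite p1_pr p2_pr.
Qed.

(* [oFst] makes the levels of [oterms] cumulative. *)
Inductive op := oZero | oOne | oAdd | oMul | oP1 | oP2 | oFst | oCst of cst_sym L.

Definition ops : seq op :=
  [:: oZero; oOne; oAdd; oMul; oP1; oP2; oFst] ++ map oCst (enum (cst_sym L)).

Lemma mem_In (T : eqType) (x : T) (s : seq T) : x \in s -> List.In x s.
Proof.
elim: s => //= y s IH; rewrite inE => /orP [/eqP ->|/IH]; first by left.
by right.
Qed.

Lemma In_map (T U : Type) (f : T -> U) x (s : seq T) :
  List.In x s -> List.In (f x) (map f s).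
Proof. by move=> xs; apply/List.in_map_iff; exists x. Qed.

Lemma ops_all o : List.In o ops.
Proof.
case: o; try by do 10! [by left | right].
by move=> c; do 7! right; apply: In_map; apply: mem_In; rewrite mem_enum.
Qed.

Definition opf (o : op) (a b : A) : A :=
  match o with
  | oZero => zero_of A
  | oOne => one_of A
  | oAdd => add_of a b
  | oMul => mul_of a b
  | oP1 => p1 a
  | oP2 => p2 a
  | oFst => a
  | oCst c => cst_of A c
  end.

(** Terms in the single variable [U], which stands for a coded tuple. Every operation takes two
    arguments and may ignore them. *)
Inductive oterm := U | Op of op & oterm & oterm.

Fixpoint ev (x : A) (t : oterm) : A :=
  if t is Op o t1 t2 then opf o (ev x t1) (ev x t2) else x.

Fixpoint osub (r t : oterm) : oterm :=
  if t is Op o t1 t2 then Op o (osub r t1) (osub r t2) else r.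

Lemma ev_osub x r t : ev x (osub r t) = ev (ev x r) t.
Proof. by elim: t => //= o t1 -> t2 ->. Qed.

Definition uP1 t := Op oP1 t U.
Definition uP2 t := Op oP2 t U.
Definition uPr t r := Op oAdd (Op oMul (Op oAdd t r) (Op oAdd t r)) t.

Lemma ev_uPr x t r : ev x (uPr t r) = pr (ev x t) (ev x r). Proof. by []. Qed.

Lemma ev_iter_uP2 x k t : ev x (iter k uP2 t) = iter k p2 (ev x t).
Proof. by elim: k => //= k ->. Qed.

Inductive atom := aEq | aLt | aRel of rel_sym L.

Definition atoms : seq atom := [:: aEq; aLt] ++ map aRel (enum (rel_sym L)).

Lemma atoms_all a : List.In a atoms.
Proof.
case: a; [by left|by right; left|move=> r; do 2! right].
by apply: In_map; apply: mem_In; rewrite mem_enum.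
Qed.

(* The atomic relations, as unary predicates on codes of tuples. *)
Definition holds (a : atom) (u : A) : Prop :=
  match a with
  | aEq => dec u 0 = dec u 1
  | aLt => lt_of (dec u 0) (dec u 1)
  | aRel r => rel_of [tuple dec u j | j < arity r]
  end.

(** A move plays one element; since it codes a tuple, it answers a whole block of quantifiers. Level
    0 compares all atomic facts about values of terms, projections included. *)
Fixpoint E n (x y : A) : Prop :=
  if n is m.+1 then
    (forall u, exists v, E m (pr u x) (pr v y)) /\
    (forall v, exists u, E m (pr u x) (pr v y))
  else forall a t, holds a (ev x t) <-> holds a (ev y t).

Lemma E_refl n x : E n x x.
Proof. by elim: n x => //= n IH x; split=> u; exists u. Qed.

Lemma E_trans n x y z : E n x y -> E n y z -> E n x z.
Proof.
elim: n x y z => [|n IH] x y z /= H K; first by move=> a t; rewrite H.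
case: H K => H1 H2 [K1 K2]; split=> u.
  by have [v uv] := H1 u; have [w vw] := K1 v; exists w; apply: IH uv vw.
by have [v uv] := K2 u; have [w vw] := H2 v; exists w; apply: IH vw uv.
Qed.

(** In the inductive step the pair of [u] and [ev z t] is again the value of a term at [pr u z], so
    the answer to a move for [x] also serves for [ev x t]. *)
Lemma E_ev n x y t : E n x y -> E n (ev x t) (ev y t).
Proof.
elim: n x y t => [|n IH] x y t /=; first by move=> H a r; rewrite -!ev_osub.
have evT u z : ev (pr u z) (uPr (uP1 U) (osub (uP2 U) t)) = pr u (ev z t).
  by rewrite ev_uPr ev_osub /= p1_pr p2_pr.
case=> H1 H2; split=> u.
  by have [v uv] := H1 u; exists v; rewrite -!evT; apply: IH.
by have [v uv] := H2 u; exists v; rewrite -!evT; apply: IH.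
Qed.

Lemma E_pred n x y : E n.+1 x y -> E n x y.
Proof.
by move=> [/(_ x) [v /(E_ev (uP2 U)) H] _]; move: H; rewrite /= !p2_pr.
Qed.

Lemma E_le m n x y : m <= n -> E n x y -> E m x y.
Proof.
elim: n => [|n IH]; first by rewrite leqn0 => /eqP ->.
by rewrite leq_eqVlt => /orP [/eqP -> //|mn /E_pred]; apply: IH.
Qed.

Lemma E_ev_eq n x y t r : E n x y -> ev x t = ev x r <-> ev y t = ev y r.
Proof.
move/(E_le (leq0n n)) => /(_ aEq (uPr t (uPr r U))) /=.
by rewrite -!/(pr _ _) /dec /= !p2_pr !p1_pr.
Qed.

Lemma E_eq n x y t r : E n x y -> ev x t = ev x r -> ev y t = ev y r.
Proof. by move/(E_ev_eq t r) ->. Qed.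

Fixpoint oterm_of (t : term L) : oterm :=
  match t with
  | tVar i => uP1 (iter i uP2 U)
  | tZero => Op oZero U U
  | tOne => Op oOne U U
  | tAdd t1 t2 => Op oAdd (oterm_of t1) (oterm_of t2)
  | tMul t1 t2 => Op oMul (oterm_of t1) (oterm_of t2)
  | tCst c => Op (oCst c) U U
  end.

Lemma ev_oterm_of x t : ev x (oterm_of t) = eval (dec x) t.
Proof. by elim: t => //= [i|t -> r -> //|t -> r -> //]; rewrite ev_iter_uP2. Qed.

Definition otuple (ts : seq oterm) : oterm := foldr uPr U ts.

Lemma dec_otuple x ts i : i < size ts -> dec (ev x (otuple ts)) i = ev x (nth U ts i).
Proof.
elim: ts i => //= t ts IH [|i] lt_i; first by rewrite -!/(pr _ _) dec_pr.
by rewrite -!/(pr _ _) dec_pr /=; apply: IH.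
Qed.

(** A quantifier rank in which a block counts once and Boolean connectives, even infinite ones,
    count nothing. Formulas at a finite level [n] of the Sigma or Pi hierarchy have rank at most
    [n]. *)
Inductive Lev : nat -> formula L -> Prop :=
| Lev_eq n t u : Lev n (fEq t u)
| Lev_lt n t u : Lev n (fLt t u)
| Lev_rel n r ts : Lev n (@fRel L r ts)
| Lev_neg n p : Lev n p -> Lev n (fNeg p)
| Lev_and n p q : Lev n p -> Lev n q -> Lev n (fAnd p q)
| Lev_or n p q : Lev n p -> Lev n q -> Lev n (fOr p q)
| Lev_bigand n f : (forall i, Lev n (f i)) -> Lev n (fBigAnd f)
| Lev_bigor n f : (forall i, Lev n (f i)) -> Lev n (fBigOr f)
| Lev_exs n k p : Lev n p -> Lev n.+1 (fExs k p)
| Lev_alls n k p : Lev n p -> Lev n.+1 (fAlls k p).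

Lemma Lev_le m n p : m <= n -> Lev m p -> Lev n p.
Proof.
move=> + Hp; elim: Hp n => {m p}; try by move=> *; constructor; auto.
- by move=> m k p _ IH [|n] // mn; apply: Lev_exs; apply: IH.
- by move=> m k p _ IH [|n] // mn; apply: Lev_alls; apply: IH.
Qed.

Lemma Lev_finitary p : finitary p -> exists n, Lev n p.
Proof.
elim: p => //=; try by move=> *; exists 0; constructor.
- by move=> p IH /IH [n Hn]; exists n; constructor.
- move=> p IHp q IHq /andP [/IHp [m Hm] /IHq [n Hn]]; exists (maxn m n).
  by constructor; [apply: Lev_le Hm; apply: leq_maxl|apply: Lev_le Hn; apply: leq_maxr].
- move=> p IHp q IHq /andP [/IHp [m Hm] /IHq [n Hn]]; exists (maxn m n).
  by constructor; [apply: Lev_le Hm; apply: leq_maxl|apply: Lev_le Hn; apply: leq_maxr].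
- by move=> p IH /IH [n Hn]; exists n.+1; apply: (@Lev_exs n 1).
- by move=> p IH /IH [n Hn]; exists n.+1; apply: (@Lev_alls n 1).
Qed.

Lemma Lev_quantifier_free p : quantifier_free p -> Lev 0 p.
Proof.
elim: p => //=; try by move=> *; constructor; auto.
- by move=> p IHp q IHq [? ?]; constructor; auto.
- by move=> p IHp q IHq [? ?]; constructor; auto.
Qed.

Fixpoint uext k (u x : oterm) : oterm :=
  if k is k'.+1 then uext k' (uP2 u) (uPr (uP1 u) x) else x.

Lemma ev_uext x k u t : ev x (uext k u t) = ext k (ev x u) (ev x t).
Proof. by elim: k u t => //= k IH u t; rewrite IH. Qed.

Lemma E_ext n k u x v y : E n (pr u x) (pr v y) -> E n (ext k u x) (ext k v y).
Proof.
move/(E_ev (uext k (uP1 U) (uP2 U))).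
by rewrite !ev_uext /= !p1_pr !p2_pr.
Qed.

Lemma E_sat n p x y : Lev n p -> E n x y -> sat (dec x) p <-> sat (dec y) p.
Proof.
move=> Hp; elim: Hp x y => {n p}.
- move=> n t u x y; rewrite /= -!ev_oterm_of; exact: E_ev_eq.
- move=> n t u x y /(E_le (leq0n n)) /(_ aLt (uPr (oterm_of t) (uPr (oterm_of u) U))) /=.
  by rewrite -!/(pr _ _) /dec /= !p2_pr !p1_pr !ev_oterm_of.
- move=> n r ts x y /(E_le (leq0n n)) /(_ (aRel r) (otuple (map oterm_of ts))) /=.
  suff H z : [tuple dec (ev z (otuple [seq oterm_of i | i <- ts])) j | j < arity r]
      = map_tuple (eval (dec z)) ts by rewrite !H.
  apply: eq_from_tnth => j; rewrite tnth_mktuple tnth_map dec_otuple.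
    rewrite (tnth_nth tZero) -ev_oterm_of (nth_map tZero) // size_tuple //.
  by rewrite size_map size_tuple.
- by move=> n p _ IH x y /IH /=; tauto.
- by move=> n p q _ IHp _ IHq x y /[dup] /IHp ? /IHq /=; tauto.
- by move=> n p q _ IHp _ IHq x y /[dup] /IHp ? /IHq /=; tauto.
- by move=> n f _ IH x y xy; split=> H i; apply/(IH i _ _ xy).
- by move=> n f _ IH x y xy; split=> -[i H]; exists i; apply/(IH i _ _ xy).
- move=> n k p _ IH x y [H1 H2]; rewrite !sat_fExs_dec; split=> -[u Hu].
    by have [v /(E_ext k) /IH uv] := H1 u; exists v; apply/uv.
  by have [v /(E_ext k) /IH uv] := H2 u; exists v; apply/uv.
- move=> n k p _ IH x y [H1 H2]; rewrite !sat_fAlls_dec; split=> H u.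
    by have [v /(E_ext k) /IH uv] := H2 u; apply/uv.
  by have [v /(E_ext k) /IH uv] := H1 u; apply/uv.
Qed.

End Pairing.

Scheme Sigma_in_ind2 := Induction for Sigma_in Sort Prop
with Pi_in_ind2 := Induction for Pi_in Sort Prop.
Combined Scheme Sigma_Pi_ind from Sigma_in_ind2, Pi_in_ind2.

Lemma olt_onat a b n : olt a b -> ole b (onat n) -> exists2 m, n = m.+1 & ole a (onat m).
Proof.
case: b => Y g [j aj]; case: n => [|n] /(_ j) []; first by case.
by move=> _ gn; exists n => //; apply: ole_trans aj gn.
Qed.

Lemma Lev_Sigma_Pi L :
  (forall a (p : formula L), Sigma_in a p -> forall n, ole a (onat n) -> Lev n p) /\
  (forall a (p : formula L), Pi_in a p -> forall n, ole a (onat n) -> Lev n p).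
Proof.
apply: Sigma_Pi_ind => a.
- by move=> p _ _ qp n _; apply: Lev_le (leq0n n) (Lev_quantifier_free qp).
- move=> g k psi ga _ IH n an; apply: Lev_bigor => i.
  by have [m -> gm] := olt_onat (ga i) an; apply: Lev_exs; apply: IH.
- by move=> p _ _ qp n _; apply: Lev_le (leq0n n) (Lev_quantifier_free qp).
- move=> g k psi ga _ IH n an; apply: Lev_bigand => i.
  by have [m -> gm] := olt_onat (ga i) an; apply: Lev_alls; apply: IH.
Qed.

(** * Omitting a type in a model of a Pi_(omega+1) sentence *)

Section OmittingType.

Variables (L : language) (M : structure L) (p1 p2 : M -> M).
Hypothesis p1_pr : forall x y, p1 (pr x y) = x.
Hypothesis p2_pr : forall x y, p2 (pr x y) = y.

Local Notation decM := (dec p1 p2).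
Local Notation E := (E p1 p2).
Local Notation ev := (ev p1 p2).

(* [Cond l x n] promises that the first [l] names of the model under construction
   keep the [E n]-type of the [l]-tuple coded by [x]; the newest name comes first. *)
Record cond := Cond { cl : nat; cx : M; cn : nat }.

Definition nm (c : cond) (i : nat) : M := decM (cx c) (cl c - i.+1).

(** Distinct names keep distinct values, so that equality in the final model can be equality of
    names. *)
Definition valid (c : cond) : Prop :=
  forall i j, i < cl c -> j < cl c -> nm c i = nm c j -> i = j.

(** Dropping the new names by [p2] leaves a tuple that may have moved, but only within its class at
    the level promised by [c]. *)
Definition cle (c c' : cond) : Prop :=
  [/\ cl c <= cl c', cn c <= cn c' &
      E (cn c) (iter (cl c' - cl c) p2 (cx c')) (cx c)].

Definition unm l i : oterm L := uP1 (iter (l - i.+1) (@uP2 L) (U L)).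

Lemma ev_unm c i : ev (cx c) (unm (cl c) i) = nm c i.
Proof. by rewrite /unm /= ev_iter_uP2. Qed.

Lemma nm_restrict c c' i : i < cl c -> cl c <= cl c' ->
  nm c' i = ev (iter (cl c' - cl c) p2 (cx c')) (unm (cl c) i).
Proof.
move=> il ll; rewrite /unm /= ev_iter_uP2 /= -iterD /nm /dec.
by rewrite addnC addnBA // subnK.
Qed.

Lemma cle_refl c : cle c c.
Proof. by split=> //; rewrite subnn; apply: E_refl. Qed.

Lemma cle_trans c c' c'' : cle c c' -> cle c' c'' -> cle c c''.
Proof.
move=> [l1 n1 e1] [l2 n2 e2]; split; [exact: leq_trans l2|exact: leq_trans n2|].
apply: E_trans e1; have := E_le p1_pr p2_pr n1 e2.
move/(E_ev p1_pr p2_pr (iter (cl c' - cl c) (@uP2 L) (U L))).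
by rewrite !ev_iter_uP2 /= -iterD addnC addnBA // subnK.
Qed.

Lemma cle_E3 c c' i j k : cle c c' -> i < cl c -> j < cl c -> k < cl c ->
  E (cn c) (pr (nm c' i) (pr (nm c' j) (nm c' k))) (pr (nm c i) (pr (nm c j) (nm c k))).
Proof.
move=> [ll _ e] il jl kl; rewrite !(nm_restrict _ ll) // -!ev_unm -!ev_uPr.
exact: E_ev.
Qed.

Lemma cle_E c c' i : cle c c' -> i < cl c -> E (cn c) (nm c' i) (nm c i).
Proof.
by move=> cc il; have := E_ev p1_pr p2_pr (uP1 (U L)) (cle_E3 cc il il il); rewrite /= !p1_pr.
Qed.

Lemma cle_opf c c' o i j k : cle c c' -> i < cl c -> j < cl c -> k < cl c ->
  nm c k = opf p1 p2 o (nm c i) (nm c j) -> nm c' k = opf p1 p2 o (nm c' i) (nm c' j).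
Proof.
move=> cc il jl kl H.
have := E_ev_eq p1_pr p2_pr (uP2 (uP2 (U L)))
  (Op o (uP1 (U L)) (uP1 (uP2 (U L)))) (cle_E3 cc il jl kl).
by rewrite /= !p2_pr !p1_pr => /iffRL; apply.
Qed.

Lemma cle_valid c c' : valid c -> cl c' = cl c -> E (cn c) (cx c') (cx c) -> valid c'.
Proof.
move=> vc ll e i j il jl; rewrite -!ev_unm ll => eq_ij.
rewrite ll in il jl; apply: vc => //; rewrite -!ev_unm.
exact: E_eq e eq_ij.
Qed.

Lemma add_name c a : valid c -> exists c', [/\ valid c', cle c c', cn c' = cn c,
  exists2 j, j < cl c' & nm c' j = a &
  forall i, i < cl c -> nm c' i = nm c i].
Proof.
move=> vc; case: (classic (exists2 j, j < cl c & nm c j = a)) => [|na].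
  by exists c; split=> //; apply: cle_refl.
exists (Cond (cl c).+1 (pr a (cx c)) (cn c)).
have nm_old i : i < cl c -> nm (Cond (cl c).+1 (pr a (cx c)) (cn c)) i = nm c i.
  by move=> il; rewrite /nm /= subSS dec_pr // -(subnSK il).
have nm_new : nm (Cond (cl c).+1 (pr a (cx c)) (cn c)) (cl c) = a.
  by rewrite /nm /= subnn dec_pr.
split=> //.
- move=> i j /=; rewrite !ltnS (leq_eqVlt i) (leq_eqVlt j).
  case: eqP => [->|_] /=; case: eqP => [->|_] //=; rewrite ?nm_new.
  + by move=> _ jl; rewrite nm_old // => aj; case: na; exists j.
  + by move=> il _; rewrite nm_old // => ai; case: na; exists i.
  + by move=> il jl; rewrite !nm_old //; apply: vc.
- by split=> //=; rewrite subSnn /= p2_pr; apply: E_refl.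
- by exists (cl c).
Qed.

Lemma raise c n : valid c -> exists c', [/\ valid c', cle c c', cl c' = cl c,
  n <= cn c' & forall i, nm c' i = nm c i].
Proof.
move=> vc; exists (Cond (cl c) (cx c) (maxn (cn c) n)).
split=> //=; last exact: leq_maxr.
by split=> //=; rewrite ?leq_maxl // subnn; apply: E_refl.
Qed.

Hypothesis infinite : forall l (g : nat -> M), exists a, forall i, i < l -> g i <> a.

Lemma allocate c l : valid c -> exists c', [/\ valid c', cle c c' & l <= cl c'].
Proof.
move=> vc; elim: l => [|l [c1 [v1 le1 ll1]]]; first by exists c; split=> //; apply: cle_refl.
have [a Ha] := infinite (cl c1) (nm c1).
have [c2 [v2 le2 _ [j jl nj] old]] := add_name a v1.
exists c2; split=> //; first exact: cle_trans le2.
rewrite (leq_ltn_trans ll1) // ltnNge; apply/negP => l21.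
have jl1 : j < cl c1 by apply: leq_trans l21.
by case: (Ha j jl1); rewrite -old.
Qed.

Variables (e : nat -> M) (b : M).
Hypothesis e_surj : forall a, exists n, e n = a.
Hypothesis b_undef : ~ definable_element b.

Let s0 : nat -> M := fun=> zero_of M.

Hypothesis conjugate : forall a, ~ definable_element a -> forall n,
  exists a' chi, [/\ E n a' a, finitary chi, free_below 1 chi,
    sat (env_cons a s0) chi & ~ sat (env_cons a' s0) chi].

Variables (g : nat -> ordinal_tree) (kk : nat -> nat) (psi : nat -> formula L).
Hypothesis g_omega : forall i, ole (g i) oomega.
Hypothesis psi_Sigma : forall i, Sigma_in (g i) (psi i).
Hypothesis M_psi : forall i (s : nat -> M), sat s (psi i).

(** [q] strengthens [p] and has finite level, so its truth is preserved by conditions that promise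
    level [n]. *)
Definition witnessed (p : formula L) (x : M) n : Prop := exists q,
  [/\ Lev n q, sat (decM x) q & forall (A : structure L) (s : nat -> A), sat s q -> sat s p].

Lemma witnessed_psi i x : exists n, witnessed (psi i) x n.
Proof.
have := M_psi i (decM x).
case: (psi_Sigma i) (g_omega i) => [a p _ _ qp _ sp|a h k theta ha Ptheta a_omega].
  by exists 0, p; split=> //; apply: Lev_quantifier_free.
move=> [j sj].
have [n hn] : exists n, ole (h j) (onat n).
  move: (ha j) a_omega => {ha}; case: a => Y f [y hy] H.
  by have [n fn] := H y; exists n; apply: ole_trans fn.
exists n.+1, (fExs (k j) (theta j)); split=> //.
  by apply: Lev_exs; apply: (proj2 (Lev_Sigma_Pi L)) hn.
by move=> A s ?; exists j.
Qed.

Definition separated (a : M) n : Prop := exists chi, [/\ Lev n chi, finitary chi,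
  free_below 1 chi, sat (env_cons b s0) chi & ~ sat (env_cons a s0) chi].

(** Countable, so that the requirements can be scheduled: existential witnesses, closure under
    operations, truth of the [psi i], and avoidance of the type of [b]. *)
Definition goal_index : Type := (nat * nat * nat * nat + nat * nat * nat + nat * nat + nat)%type.

(** The requirement refers to a fixed element [y] of [M] because the value of the name [i] may
    change between stages. *)
Definition realizes i n y a (c : cond) : Prop := [/\ i < cl c, n < cn c &
  E n.+1 (nm c i) y -> exists2 j, j < cl c & E n (pr (nm c j) (nm c i)) (pr a y)].

Definition closes o i j (c : cond) : Prop :=
  [/\ i < cl c, j < cl c & exists2 k, k < cl c & nm c k = opf p1 p2 o (nm c i) (nm c j)].

Definition goal (d : goal_index) (c : cond) : Prop :=
  match d with
  | inl (inl (inl (i, n, y, a))) => realizes i n (e y) (e a) c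
  | inl (inl (inr (o, i, j))) => closes (nth (oFst L) (ops L) o) i j c
  | inl (inr (i, k)) => k < cl c /\ witnessed (psi i) (nm c k) (cn c)
  | inr k => k < cl c /\ separated (nm c k) (cn c)
  end.

Lemma witnessed_le p x m n : m <= n -> witnessed p x m -> witnessed p x n.
Proof. by move=> mn [q [? ? ?]]; exists q; split=> //; apply: Lev_le mn _. Qed.

Lemma separated_le x m n : m <= n -> separated x m -> separated x n.
Proof. by move=> mn [q [? ? ? ? ?]]; exists q; split=> //; apply: Lev_le mn _. Qed.

Lemma realizes_dense i n y a c : valid c ->
  exists c', [/\ valid c', cle c c' & realizes i n y a c'].
Proof.
move=> vc; have [c1 [v1 le1 l1]] := allocate i.+1 vc.
have [c2 [v2 le2 l2 n2 nm2]] := raise n.+1 v1.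
have le02 := cle_trans le1 le2.
case: (classic (E n.+1 (nm c2 i) y)) => [eqv|neqv]; last first.
  by exists c2; split=> //; split; rewrite ?l2.
have [_ /(_ a) [a' ea']] := eqv.
have [c3 [v3 le3 n3 [j jl nj] old]] := add_name a' v2.
exists c3; split=> //; first exact: cle_trans le3.
have il2 : i < cl c2 by rewrite l2.
split; first by case: le3 => ll _ _; apply: leq_trans ll.
  by rewrite n3.
by move=> _; exists j => //; rewrite nj old.
Qed.

Lemma closes_dense o i j c : valid c ->
  exists c', [/\ valid c', cle c c' & closes o i j c'].
Proof.
move=> vc; have [c1 [v1 le1 l1]] := allocate (maxn i j).+1 vc.
have il1 : i < cl c1 by apply: leq_trans l1; rewrite ltnS leq_maxl.
have jl1 : j < cl c1 by apply: leq_trans l1; rewrite ltnS leq_maxr.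
have [c2 [v2 le2 _ [k kl nk] old]] := add_name (opf p1 p2 o (nm c1 i) (nm c1 j)) v1.
have [ll _ _] := le2.
exists c2; split=> //; first exact: cle_trans le2.
split; [exact: leq_trans ll|exact: leq_trans ll|].
by exists k => //; rewrite nk (old i) // (old j).
Qed.

(** A formula defining [a] either holds of [b], which is then [a] itself, or its negation would pass
    from [b] to [a]. *)
Lemma undefinable_type a : (forall chi, finitary chi -> free_below 1 chi ->
  sat (env_cons b s0) chi -> sat (env_cons a s0) chi) -> ~ definable_element a.
Proof.
move=> ba a_def; have [phi [fp [bp H]]] := a_def.
case: (classic (sat (env_cons b s0) phi)) => [/H ba'|nb].
  by apply: b_undef; exists phi; split=> //; split=> // x s; rewrite ba' H.
exact: (ba (fNeg phi) fp bp nb) (proj2 (H a s0) erefl).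
Qed.

(** If the value [a] of the name realizes the type of [b], it is undefinable too, so [conjugate]
    yields an equivalent [a'] of another type to replace it. *)
Lemma separated_dense k c : valid c ->
  exists c', [/\ valid c', cle c c' & k < cl c' /\ separated (nm c' k) (cn c')].
Proof.
move=> vc; have [c1 [v1 le1 l1]] := allocate k.+1 vc; set a := nm c1 k.
have [c2 [v2 le2 l2 [d sep2]]] : exists c2, [/\ valid c2, cle c1 c2, cl c2 = cl c1 &
    exists d, separated (nm c2 k) d].
  case: (classic (exists d, separated a d)) => [?|nsep].
    by exists c1; split=> //; apply: cle_refl.
  have ba chi : finitary chi -> free_below 1 chi ->
      sat (env_cons b s0) chi -> sat (env_cons a s0) chi.
    move=> fc bc sc; apply: NNPP => nc; apply: nsep.
    by have [d Ld] := Lev_finitary fc; exists d, chi.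
  (* One level more than promised is asked for, since carrying the whole tuple [cx c1] along with
     [a] costs one move. *)
  have [a' [chi [eaa fc bc sc nc]]] := conjugate (undefinable_type ba) (cn c1).+1.
  have [_ /(_ (cx c1)) [x' ex]] := eaa.
  have e1 : E (cn c1) x' (cx c1).
    by have := E_ev p1_pr p2_pr (uP1 (U L)) ex; rewrite /= !p1_pr.
  exists (Cond (cl c1) x' (cn c1)); split=> //.
  - by apply: (cle_valid v1).
  - by split=> //=; rewrite subnn.
  (* That [a] is an entry of the tuple is an equation between terms in the pair, so it transfers to
     [a'] and [x']. *)
  have -> : nm (Cond (cl c1) x' (cn c1)) k = a'.
    have := E_ev_eq p1_pr p2_pr (osub (uP1 (U L)) (unm (cl c1) k)) (uP2 (U L)) ex.
    have ev1 u v : ev (pr u v) (uP1 (U L)) = u by rewrite /= p1_pr.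
    have ev2 u v : ev (pr u v) (uP2 (U L)) = v by rewrite /= p2_pr.
    rewrite !ev_osub !ev1 !ev2 (ev_unm c1) (ev_unm (Cond (cl c1) x' (cn c1))).
    by move=> [_ H]; apply: H.
  have [d Ld] := Lev_finitary fc; exists d, chi; split=> //.
  by apply: NNPP => /(ba (fNeg chi) fc bc).
have [c3 [v3 le3 l3 n3 nm3]] := raise d v2.
exists c3; split=> //; first exact: cle_trans (cle_trans le1 le2) le3.
by rewrite l3 l2 nm3; split=> //; apply: separated_le sep2.
Qed.

Lemma goal_dense d c : valid c -> exists c', [/\ valid c', cle c c' & goal d c'].
Proof.
case: d => [[[[[[i n] y] a]|[[o i] j]]|[i k]]|k] vc.
- exact: realizes_dense.
- exact: closes_dense.
- have [c1 [v1 le1 l1]] := allocate k.+1 vc.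
  have [n Hn] := witnessed_psi i (nm c1 k).
  have [c2 [v2 le2 l2 n2 nm2]] := raise n v1.
  exists c2; split=> //=; first exact: cle_trans le2.
  by rewrite l2 nm2; split=> //; apply: witnessed_le Hn.
- exact: separated_dense.
Qed.

Lemma generic_sequence : exists G : nat -> cond,
  [/\ forall p, valid (G p), forall p q, p <= q -> cle (G p) (G q) &
      forall d N, exists2 q, N <= q & goal d (G q)].
Proof.
have /fchoice [step Hstep] : forall kc : nat * cond, exists c', valid kc.2 ->
    [/\ valid c', cle kc.2 c' & forall d, unpickle kc.1 = Some d -> goal d c'].
  move=> [k c] /=; case: (classic (valid c)) => vc; last by exists c.
  case Ek: (unpickle k) => [d|]; last by exists c; split=> //; apply: cle_refl.
  by have [c' [? ? ?]] := goal_dense d vc; exists c' => _; split=> // d' [<-].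
(* The exponent of 2 in [q.+1] takes every value infinitely often, so each goal is served at
   arbitrarily late stages. *)
pose G := fix G p := if p is q.+1 then step (logn 2 q.+1, G q) else Cond 0 (zero_of M) 0.
have vG p : valid (G p) by elim: p => // p IH; have [] := Hstep (logn 2 p.+1, G p) IH.
exists G; split=> // [p q|d N].
  elim: q => [|q IH]; first by rewrite leqn0 => /eqP ->; apply: cle_refl.
  rewrite leq_eqVlt => /orP [/eqP ->|/IH le_pq]; first exact: cle_refl.
  by apply: cle_trans le_pq _; have [] := Hstep (logn 2 q.+1, G q) (vG q).
pose q := (2 ^ pickle d * N.*2.+1).-1.
have qE : q.+1 = 2 ^ pickle d * N.*2.+1 by rewrite prednK // muln_gt0 expn_gt0.
have lq : logn 2 q.+1 = pickle d.
  rewrite qE lognM ?expn_gt0 // pfactorK // logn_coprime ?addn0 //.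
  by rewrite coprime2n /= odd_double.
exists q.+1.
  rewrite qE; apply: leq_trans (leq_pmull _ _); last by rewrite expn_gt0.
  by rewrite -addnn; apply: leq_trans (leq_addr N N) _.
have [_ _] := Hstep (logn 2 q.+1, G q) (vG q); apply.
by rewrite lq pickleK.
Qed.

(** * The generic model and its truth lemma *)

Section GenericModel.

Variable G : nat -> cond.
Hypothesis G_valid : forall p, valid (G p).
Hypothesis G_mono : forall p q, p <= q -> cle (G p) (G q).
Hypothesis G_goal : forall d N, exists2 q, N <= q & goal d (G q).

Definition evt (R : cond -> Prop) : Prop := exists N, forall q, N <= q -> R (G q).

Lemma evt_and R S : evt R -> evt S -> evt (fun c => R c /\ S c).
Proof.
move=> [m Rm] [n Sn]; exists (maxn m n) => q.
by rewrite geq_max => /andP [/Rm ? /Sn ?].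
Qed.

Lemma evt_impl (R S : cond -> Prop) : (forall c, R c -> S c) -> evt R -> evt S.
Proof. by move=> RS [n Rn]; exists n => q /Rn /RS. Qed.

Lemma evt_ge R p : evt R -> exists2 q, p <= q & R (G q).
Proof. by case=> n Rn; exists (maxn n p); rewrite ?leq_maxr //; apply: Rn; apply: leq_maxl. Qed.

Lemma evt_alloc i : evt (fun c => i < cl c).
Proof.
have [p _ [ip _]] := G_goal (inr i) 0; exists p => q /G_mono [ll _ _].
exact: leq_trans ll.
Qed.

Lemma evt_cn n : evt (fun c => n < cn c).
Proof.
have [p _ [_ np _]] := G_goal (inl (inl (inl (0, n, 0, 0)))) 0.
by exists p => q /G_mono [_ nn _]; apply: leq_trans nn.
Qed.

Lemma nm_inj i j : evt (fun c => nm c i = nm c j) -> i = j.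
Proof.
move=> H; have [q _ [[il jl] ij]] := evt_ge 0 (evt_and (evt_and (evt_alloc i) (evt_alloc j)) H).
exact: G_valid ij.
Qed.

Lemma opN_exists : exists opN : op L -> nat -> nat -> nat, forall o i j,
  evt (fun c => nm c (opN o i j) = opf p1 p2 o (nm c i) (nm c j)).
Proof.
suff /fchoice [f Hf] (x : op L * nat * nat) : exists k,
    evt (fun c => nm c k = opf p1 p2 x.1.1 (nm c x.1.2) (nm c x.2)).
  by exists (fun o i j => f (o, i, j)) => o i j; apply: (Hf (o, i, j)).
case: x => [[o i] j] /=.
have [n <-] : exists n, nth (oFst L) (ops L) n = o.
  elim: (ops L) (ops_all o) => //= x l IH [->|/IH [n <-]]; first by exists 0.
  by exists n.+1.
have [p _ [il jl [k kl Hk]]] := G_goal (inl (inl (inr (n, i, j)))) 0.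
by exists k, p => q /G_mono le_pq; apply: cle_opf le_pq _ _ _ Hk.
Qed.

Variable opN : op L -> nat -> nat -> nat.
Hypothesis opN_nm : forall o i j,
  evt (fun c => nm c (opN o i j) = opf p1 p2 o (nm c i) (nm c j)).

(** No quotient is taken, since distinct names have distinct values. *)
Definition N : structure L := @Structure L nat
  (opN (oZero L) 0 0) (opN (oOne L) 0 0) (opN (oAdd L)) (opN (oMul L))
  (fun i j => evt (fun c => lt_of (nm c i) (nm c j)))
  (fun r t => evt (fun c => rel_of (map_tuple (nm c) t)))
  (fun c => opN (oCst c) 0 0).

Definition q1 (i : N) : N := opN (oP1 L) i i.
Definition q2 (i : N) : N := opN (oP2 L) i i.

Lemma nm_pr (i j : N) : evt (fun c => nm c (pr i j) = pr (nm c i) (nm c j)).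
Proof.
have H1 := opN_nm (oAdd L) i j.
have H2 := opN_nm (oMul L) (opN (oAdd L) i j) (opN (oAdd L) i j).
have H3 := opN_nm (oAdd L) (opN (oMul L) (opN (oAdd L) i j) (opN (oAdd L) i j)) i.
by apply: evt_impl (evt_and H1 (evt_and H2 H3)) => c [/= E1 [E2 ->]]; rewrite E2 E1.
Qed.

Lemma q1_pr (i j : N) : q1 (pr i j) = i.
Proof.
apply: nm_inj; apply: evt_impl (evt_and (nm_pr i j) (opN_nm (oP1 L) (pr i j) (pr i j))).
by move=> c [E1 ->] /=; rewrite E1 p1_pr.
Qed.

Lemma q2_pr (i j : N) : q2 (pr i j) = j.
Proof.
apply: nm_inj; apply: evt_impl (evt_and (nm_pr i j) (opN_nm (oP2 L) (pr i j) (pr i j))).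
by move=> c [E1 ->] /=; rewrite E1 p2_pr.
Qed.

Local Notation decN := (dec q1 q2).

Lemma nm_dec (i : N) j : evt (fun c => nm c (decN i j) = decM (nm c i) j).
Proof.
have H : evt (fun c => nm c (iter j q2 i) = iter j p2 (nm c i)).
  elim: j => [|j IH]; first by exists 0.
  apply: evt_impl (evt_and IH (opN_nm (oP2 L) (iter j q2 i) (iter j q2 i))).
  by move=> c /= [<- ->].
apply: evt_impl (evt_and H (opN_nm (oP1 L) (iter j q2 i) (iter j q2 i))).
by move=> c /= [E1 E2]; rewrite /dec -E1.
Qed.

Lemma nm_ext k (u i : N) :
  evt (fun c => nm c (ext q1 q2 k u i) = ext p1 p2 k (nm c u) (nm c i)).
Proof.
elim: k u i => [|k IH] u i; first by exists 0.
have H1 := opN_nm (oP1 L) u u; have H2 := opN_nm (oP2 L) u u.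
apply: evt_impl (evt_and (IH (q2 u) (pr (q1 u) i))
  (evt_and H1 (evt_and H2 (nm_pr (q1 u) i)))) => c /= [-> [E1 [E2 ->]]].
by rewrite /q1 /q2 E1 E2.
Qed.

Lemma nm_eval (i : N) t : evt (fun c => nm c (eval (decN i) t) = eval (decM (nm c i)) t).
Proof.
elim: t => [j| | |t IHt u IHu|t IHt u IHu|k] /=.
- exact: nm_dec.
- exact: opN_nm.
- exact: opN_nm.
- apply: evt_impl (evt_and IHt (evt_and IHu (opN_nm (oAdd L) (eval (decN i) t) (eval (decN i) u)))).
  by move=> c /= [<- [<- ->]].
- apply: evt_impl (evt_and IHt (evt_and IHu (opN_nm (oMul L) (eval (decN i) t) (eval (decN i) u)))).
  by move=> c /= [<- [<- ->]].
- exact: opN_nm.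
Qed.

(** The truth lemma for [p], with the stage made explicit: truth is settled once the name is in use
    and level [n] is promised. *)
Definition decided n (p : formula L) : Prop := forall (i : N) k, i < cl (G k) -> n <= cn (G k) ->
  (sat (decN i) p <-> sat (decM (nm (G k) i)) p).

Lemma sat_stable n p i k q : Lev n p -> i < cl (G k) -> n <= cn (G k) -> k <= q ->
  sat (decM (nm (G q) i)) p <-> sat (decM (nm (G k) i)) p.
Proof.
move=> Lp ik nk kq; apply: (E_sat p1_pr p2_pr Lp).
exact: E_le nk (cle_E (G_mono kq) ik).
Qed.

Lemma decided_evt n p : Lev n p ->
  (forall i : N, sat (decN i) p <-> evt (fun c => sat (decM (nm c i)) p)) -> decided n p.
Proof.
move=> Lp H i k ik nk; rewrite H; split=> [/(evt_ge k) [q kq]|Hk].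
  by rewrite (sat_stable Lp ik nk kq).
by exists k => q kq; rewrite (sat_stable Lp ik nk kq).
Qed.

Lemma decided_at n p (i : N) : decided n p ->
  evt (fun c => sat (decN i) p <-> sat (decM (nm c i)) p).
Proof.
move=> dp; have [m Hm] := evt_and (evt_alloc i) (evt_cn n).
by exists m => q /Hm [iq /ltnW nq]; apply: dp.
Qed.

Lemma decided_neg n p : decided n p -> decided n (fNeg p).
Proof. by move=> dp i k ik nk /=; rewrite (dp i k ik nk). Qed.

(** A witness in [N] has a value at a later stage, where truth agrees with stage [q]. Conversely, a
    witness at stage [q] is turned into a name by a [realizes] goal met later. *)
Lemma decided_exs n k p : Lev n p -> decided n p -> decided n.+1 (fExs k p).
Proof.
move=> Lp dp i q iq nq; rewrite (sat_fExs_dec q1_pr q2_pr) (sat_fExs_dec p1_pr p2_pr).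
have dext u := evt_and (nm_ext k u i) (decided_at (ext q1 q2 k u i) dp).
split=> [[u Hu]|[u Hu]].
  apply/(sat_fExs_dec p1_pr p2_pr).
  have [r qr [E1 E2]] := evt_ge q (dext u).
  apply/(sat_stable (Lev_exs k Lp) iq nq qr); apply/(sat_fExs_dec p1_pr p2_pr).
  by exists (nm (G r) u); rewrite -E1 -E2.
(* The goal is set up with the value of [i] at stage [q]. At stage [r] this name is still in the
   same class at level [n.+1], so the premise of the goal holds. *)
have [y Ey] := e_surj (nm (G q) i); have [a Ea] := e_surj u.
have [r qr [ir nr]] := G_goal (inl (inl (inl (i, n, y, a)))) q.
rewrite Ey Ea => /(_ (E_le p1_pr p2_pr nq (cle_E (G_mono qr) iq))) [j jr Ej].
exists j; have [r' rr' [E1 ->]] := evt_ge r (dext j).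
rewrite E1; apply/(E_sat p1_pr p2_pr Lp); last exact: Hu.
apply: (E_ext p1_pr p2_pr); apply: E_trans Ej.
have := cle_E3 (G_mono rr') jr ir ir.
move/(E_ev p1_pr p2_pr (uPr (uP1 (U L)) (uP1 (uP2 (U L))))).
rewrite !ev_uPr /= !p2_pr !p1_pr; apply: E_le => //; exact: ltnW.
Qed.

Lemma truth n p : Lev n p -> decided n p.
Proof.
elim=> {n p}.
- move=> n t u; apply: decided_evt; first exact: Lev_eq.
  move=> i /=; have H := evt_and (nm_eval i t) (nm_eval i u); split=> [tu|tu].
    by apply: evt_impl H => c [<- <-]; rewrite tu.
  by apply: nm_inj; apply: evt_impl (evt_and H tu) => c [[-> ->]].
- move=> n t u; apply: decided_evt; first exact: Lev_lt.
  move=> i /=; have H := evt_and (nm_eval i t) (nm_eval i u).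
  by split=> tu; apply: evt_impl (evt_and H tu) => c [[-> ->]].
- move=> n r ts; apply: decided_evt; first exact: Lev_rel.
  move=> i; have Hm : evt (fun c => map_tuple (nm c) (map_tuple (eval (decN i)) ts)
      = map_tuple (eval (decM (nm c i))) ts).
    have : evt (fun c => forall t, List.In t ts -> nm c (eval (decN i) t) = eval (decM (nm c i)) t).
      elim: (tval ts) => [|t l IH]; first by exists 0.
      by apply: evt_impl (evt_and IH (nm_eval i t)) => c [Hl Ht] t' [<-|/Hl].
    apply: evt_impl => c Hc; apply: eq_from_tnth => j; rewrite !tnth_map.
    exact/Hc/In_tnth.
  split=> tu; apply: evt_impl (evt_and tu Hm) => c [].
    by move=> /= ? <-.
  by move=> /= ? ->.
- by move=> n p _; apply: decided_neg.
- by move=> n p q _ dp _ dq i k ik nk /=; rewrite (dp i k ik nk) (dq i k ik nk).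
- by move=> n p q _ dp _ dq i k ik nk /=; rewrite (dp i k ik nk) (dq i k ik nk).
- by move=> n f _ df i k ik nk /=; split=> H j; apply/(df j i k ik nk).
- by move=> n f _ df i k ik nk /=; split=> -[j H]; exists j; apply/(df j i k ik nk).
- by move=> n k p; apply: decided_exs.
- move=> n k p Lp dp.
  have dnp := decided_exs k (Lev_neg Lp) (decided_neg dp).
  have alls (A : structure L) (s : nat -> A) : sat s (fAlls k p) <-> ~ sat s (fExs k (fNeg p)).
    rewrite -sat_fAlls_neg; apply: sat_fAlls_eq => s' /=; split=> [? //|]; exact: NNPP.
  by move=> i q iq nq; rewrite !alls (dnp i q iq nq).
Qed.

(** A universal block amounts to one name [w]; its goal provides a finite-level formula true of [w]
    and implying [psi i], to which the truth lemma applies. *)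
Lemma N_sentence : sentence (fBigAnd (fun i => fAlls (kk i) (psi i))) ->
  models N (fBigAnd (fun i => fAlls (kk i) (psi i))).
Proof.
move=> sen s; apply/(@sat_free _ _ _ 0 _ (decN 0) sen) => // i.
apply/(sat_fAlls_dec q1_pr q2_pr) => u; set w := ext _ _ _ _ _.
have [q _ [wq [p [Lp sp pq]]]] := G_goal (inl (inr (i, w))) 0.
by apply: pq; apply/(truth Lp wq).
Qed.

(** An isomorphism would give the name [h b] the type of [b], against the formula that separates the
    value of this name from [b]. *)
Lemma N_not_isomorphic : ~ isomorphic M N.
Proof.
move=> [h hiso]; have [q _ [hq [chi [Lc fc bc sb nb]]]] := G_goal (inr (h b)) 0.
(* The truth lemma speaks of environments coded by a name, so the one-variable formula is read at a
   pair with head [h b] and the name 0 as an arbitrary tail. *)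
have [k Ek] : exists k, k = pr (h b : N) 0 :> N by exists (pr (h b : N) 0).
apply: nb; have [r qr [[kr nr] [Ek' E0]]] := evt_ge q (evt_and (evt_and (evt_alloc k)
  (evt_cn (cn (G q)))) (evt_and (nm_pr (h b) 0) (evt_alloc (h b)))).
have Et : nm (G r) k = pr (nm (G r) (h b)) (nm (G r) 0) by rewrite Ek.
have sk : sat (decN k) chi.
  rewrite Ek (dec_pr q1_pr q2_pr).
  apply/(@sat_free _ _ _ 1 _ (env_cons (h b) (h \o s0)) bc); first by case.
  by rewrite -env_cons_comp; apply/(sat_iso _ _ hiso).
have := (truth Lc kr (ltnW nr)).1 sk; rewrite Et (dec_pr p1_pr p2_pr).
have hbE := E_sat p1_pr p2_pr Lc (cle_E3 (G_mono qr) hq hq hq).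
move: hbE; rewrite !(dec_pr p1_pr p2_pr) => hbE H.
have sf x (s s' : nat -> M) := @sat_free _ M _ 1 (env_cons x s) (env_cons x s') bc.
apply/(sf _ _ (env_cons (nm (G q) (h b)) (decM (nm (G q) (h b))))); first by case.
by apply/hbE; apply/(sf _ _ (decM (nm (G r) 0))) => //; case.
Qed.

End GenericModel.

Lemma not_scott_sentence : ~ scott_sentence M (fBigAnd (fun i => fAlls (kk i) (psi i))).
Proof.
move=> [sen iff]; have [G [vG mG gG]] := generic_sequence.
have [opN HopN] := opN_exists mG gG.
apply: (N_not_isomorphic vG mG gG HopN); apply/iff; last exact: N_sentence.
by exists id.
Qed.

End OmittingType.

(** * Arithmetic, coding and overspill in a model of PA *)

Section Arithmetic.

Variables (L : language) (M : structure L).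
Hypothesis hPA : models_PA M.

Local Notation "0" := (zero_of M).
Local Notation "1" := (one_of M).
Local Notation "x +! y" := (@add_of L M x y) (at level 50, left associativity).
Local Notation "x *! y" := (@mul_of L M x y) (at level 40, left associativity).
Local Notation "x <! y" := (@lt_of L M x y) (at level 70).

(** Hooks of the definability tactics, redefined below as new definable functions and predicates
    become available. *)
Ltac dtm_ext := fail.
Ltac dfn_ext := fail.

Ltac dtm_tac :=
  cbv beta;
  first
  [ apply: dtm_zero | apply: dtm_one | apply: dtm_cst
  | lazymatch goal with
    | |- dtm _ (fun s => add_of _ _) => apply: dtm_add; dtm_tac
    | |- dtm _ (fun s => mul_of _ _) => apply: dtm_mul; dtm_tac
    | |- dtm _ (fun s => s _) => exact: dtm_var
    end
  | dtm_ext ].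

Ltac dfn_tac :=
  cbv beta;
  first
  [ lazymatch goal with
    | |- dfn _ (fun s => _ /\ _) => apply: dfn_and; dfn_tac
    | |- dfn _ (fun s => _ \/ _) => apply: dfn_or; dfn_tac
    | |- dfn _ (fun s => _ <-> _) => apply: dfn_equiv; dfn_tac
    | |- dfn _ (fun s => ~ _) => apply: dfn_not; dfn_tac
    | |- dfn _ (fun s => ex _) => apply: dfn_ex; dfn_tac
    | |- dfn _ (fun s => _ = _) => apply: dfn_eq; dtm_tac
    | |- dfn _ (fun s => lt_of _ _) => apply: dfn_lt; dtm_tac
    | |- dfn _ (fun s => forall a, _) =>
        first [apply: dfn_imp | apply: dfn_all]; dfn_tac
    end
  | dfn_ext ].

Lemma dind k (P : (nat -> M) -> Prop) s : dfn k P ->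
  P (env_cons 0 s) -> (forall x, P (env_cons x s) -> P (env_cons (x +! 1) s)) ->
  forall x, P (env_cons x s).
Proof.
move=> [phi [fp _ H]] P0 PS x; apply/H; apply: (PA_induction hPA) => //.
  exact/H.
by move=> y /H /PS /H.
Qed.

Let s0 : nat -> M := fun=> 0.

Lemma ind0 (Q : M -> Prop) : dfn 1 (fun s : nat -> M => Q (s 0%N)) ->
  Q 0 -> (forall x, Q x -> Q (x +! 1)) -> forall x, Q x.
Proof. by move=> dQ Q0 QS; apply: (@dind 1 (fun s => Q (s 0%N)) s0). Qed.

Lemma ind1 (Q : M -> M -> Prop) p : dfn 2 (fun s : nat -> M => Q (s 0%N) (s 1%N)) ->
  Q 0 p -> (forall x, Q x p -> Q (x +! 1) p) -> forall x, Q x p.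
Proof.
by move=> dQ Q0 QS; apply: (@dind 2 (fun s => Q (s 0%N) (s 1%N)) (env_cons p s0)).
Qed.

Lemma ind2 (Q : M -> M -> M -> Prop) p q :
  dfn 3 (fun s : nat -> M => Q (s 0%N) (s 1%N) (s 2)) ->
  Q 0 p q -> (forall x, Q x p q -> Q (x +! 1) p q) -> forall x, Q x p q.
Proof.
move=> dQ Q0 QS.
by apply: (@dind 3 (fun s => Q (s 0%N) (s 1%N) (s 2)) (env_cons p (env_cons q s0))).
Qed.

Lemma addm0 x : x +! 0 = x. Proof. exact: PA_add0. Qed.
Lemma addmS x y : x +! (y +! 1) = x +! y +! 1. Proof. exact: PA_addS. Qed.
Lemma mulm0 x : x *! 0 = 0. Proof. exact: PA_mul0. Qed.
Lemma mulmS x y : x *! (y +! 1) = x *! y +! x. Proof. exact: PA_mulS. Qed.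

Lemma add0m x : 0 +! x = x.
Proof.
by elim/ind0: x => [||x IH]; [dfn_tac|rewrite addm0|rewrite addmS IH].
Qed.

Lemma addSm x y : x +! 1 +! y = x +! y +! 1.
Proof.
apply: (@ind1 (fun y x => x +! 1 +! y = x +! y +! 1)); [dfn_tac|by rewrite !addm0|].
by move=> {}y IH; rewrite !addmS IH.
Qed.

Lemma addmC x y : x +! y = y +! x.
Proof.
apply: (@ind1 (fun y x => x +! y = y +! x)); [dfn_tac|by rewrite addm0 add0m|].
by move=> {}y IH; rewrite addmS addSm IH.
Qed.

Lemma addmA x y z : x +! (y +! z) = x +! y +! z.
Proof.
apply: (@ind2 (fun z x y => x +! (y +! z) = x +! y +! z)); [dfn_tac|by rewrite !addm0|].
by move=> {}z IH; rewrite !addmS IH.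
Qed.

Lemma mul0m x : 0 *! x = 0.
Proof.
by elim/ind0: x => [||x IH]; [dfn_tac|rewrite mulm0|rewrite mulmS IH addm0].
Qed.

Lemma mulSm x y : (x +! 1) *! y = x *! y +! y.
Proof.
apply: (@ind1 (fun y x => (x +! 1) *! y = x *! y +! y)); [dfn_tac| |].
  by rewrite !mulm0 addm0.
by move=> {}y IH; rewrite !mulmS IH -!addmA; congr (_ +! _); rewrite addmC -!addmA (addmC 1).
Qed.

Lemma mulmC x y : x *! y = y *! x.
Proof.
apply: (@ind1 (fun y x => x *! y = y *! x)); [dfn_tac|by rewrite mulm0 mul0m|].
by move=> {}y IH; rewrite mulmS mulSm IH.
Qed.

Lemma mulmDr x y z : x *! (y +! z) = x *! y +! x *! z.
Proof.
apply: (@ind2 (fun z x y => x *! (y +! z) = x *! y +! x *! z)); [dfn_tac| |].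
  by rewrite mulm0 !addm0.
by move=> {}z IH; rewrite addmS !mulmS IH addmA.
Qed.

Lemma mulmA x y z : x *! (y *! z) = x *! y *! z.
Proof.
apply: (@ind2 (fun z x y => x *! (y *! z) = x *! y *! z)); [dfn_tac|by rewrite !mulm0|].
by move=> {}z IH; rewrite !mulmS mulmDr IH.
Qed.

Lemma mul1m x : 1 *! x = x.
Proof. by rewrite -(add0m 1) mulSm mul0m add0m. Qed.

Lemma M_srt : semi_ring_theory 0 1 (@add_of L M) (@mul_of L M) (@eq M).
Proof.
split; [exact: add0m|exact: addmC|exact: addmA|exact: mul1m|exact: mul0m|exact: mulmC|exact: mulmA|].
by move=> x y z; rewrite mulmC mulmDr (mulmC z x) (mulmC z y).
Qed.

Add Ring Mring : M_srt.

Lemma succ_neq0 x : x +! 1 <> 0. Proof. exact: PA_succ_neq0. Qed.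
Lemma succ_inj x y : x +! 1 = y +! 1 -> x = y. Proof. exact: PA_succ_inj. Qed.

Lemma addIm x y z : x +! z = y +! z -> x = y.
Proof.
apply: (@ind2 (fun z x y => x +! z = y +! z -> x = y)); [dfn_tac|by rewrite !addm0|].
by move=> {}z IH; rewrite !addmS => /succ_inj.
Qed.

Lemma addmI x y z : z +! x = z +! y -> x = y.
Proof. by rewrite !(addmC z); apply: addIm. Qed.

Lemma zero_or_succ x : x = 0 \/ exists y, x = y +! 1.
Proof.
by elim/ind0: x => [||x IH]; [dfn_tac|left|right; exists x].
Qed.

Lemma ltE x y : x <! y <-> exists z, x +! (z +! 1) = y.
Proof. exact: PA_lt. Qed.

Lemma ltmm x : ~ x <! x.
Proof.
by move/ltE=> [z]; rewrite -[X in _ = X]addm0 => /addmI /succ_neq0.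
Qed.

Lemma lt_trans x y z : x <! y -> y <! z -> x <! z.
Proof.
move=> /ltE [u <-] /ltE [v <-]; apply/ltE; exists (u +! v +! 1); ring.
Qed.

Lemma ltm0 x : ~ x <! 0.
Proof. by move/ltE=> [z]; rewrite addmS => /succ_neq0. Qed.

Lemma ltmS x y : x <! y +! 1 <-> x <! y \/ x = y.
Proof.
split=> [/ltE [z]|[/ltE [z <-]|->]].
- rewrite addmS => /succ_inj; have [->|[w ->] xy] := zero_or_succ z.
    by rewrite addm0; right.
  by left; apply/ltE; exists w.
- by apply/ltE; exists (z +! 1); ring.
- by apply/ltE; exists 0; ring.
Qed.

Lemma ltSm x : x <! x +! 1. Proof. by apply/ltmS; right. Qed.

Lemma lt_total x y : x <! y \/ x = y \/ y <! x.
Proof.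
apply: (@ind1 (fun x y => x <! y \/ x = y \/ y <! x)); [dfn_tac| |].
  have [->|[z ->]] := zero_or_succ y; first by right; left.
  by left; apply/ltE; exists z; ring.
move=> {}x [/ltE [z <-]|[->|yx]].
- have [->|[w ->]] := zero_or_succ z; first by right; left; ring.
  by left; apply/ltE; exists w; ring.
- by right; right; apply: ltSm.
- by right; right; apply: lt_trans yx (ltSm x).
Qed.

Lemma lt_addr x y : x <! x +! y +! 1.
Proof. by apply/ltE; exists y; ring. Qed.

Lemma dind_strong k (P : (nat -> M) -> Prop) s : dfn k.+1 P ->
  (forall x, (forall y, y <! x -> P (env_cons y s)) -> P (env_cons x s)) ->
  forall x, P (env_cons x s).
Proof.
move=> dP step.
pose Q (s : nat -> M) := forall y, y <! s 0%N -> P (env_cons y (fun i => s i.+1)).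
have dQ : dfn k.+1 Q.
  apply: dfn_all; apply: dfn_imp; first by dfn_tac.
  pose r i := if i is j.+1 then j.+2 else 0%N.
  have : dfn k.+2 (fun s => P (fun i => s (r i))) by apply: dfn_ren dP; case.
  apply: dfn_iff => t.
  by have -> : (fun i => t (r i)) = env_cons (t 0%N) (fun i => t i.+2)
    by apply: functional_extensionality; case.
have HQ x : Q (env_cons x s).
  apply: (dind dQ) => [y /ltm0 //|{}x Qx y /ltmS [/Qx //|->]].
  exact: step.
move=> x; exact: HQ (x +! 1) x (ltSm x).
Qed.

Lemma least k (P : (nat -> M) -> Prop) s x : dfn k.+1 P -> P (env_cons x s) ->
  exists2 y, P (env_cons y s) & forall z, z <! y -> ~ P (env_cons z s).
Proof.
move=> dP Px; apply: NNPP => H.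
apply: (@dind_strong k (fun s => ~ P s) s _ _ x) => //; first exact: dfn_not.
by move=> y Hy Py; apply: H; exists y.
Qed.

(** Passing from the square of a sum to the next square adds more than the summand [x], so equal
    codes have equal sums. *)
Lemma pr_inj (x y x' y' : M) : pr x y = pr x' y' -> x = x' /\ y = y'.
Proof.
have gap (x1 y1 x2 y2 : M) : x1 +! y1 <! x2 +! y2 -> pr x1 y1 <> pr x2 y2.
  move=> /ltE [w Ew]; rewrite /pr -Ew => H; apply: (@ltmm x1).
  apply/ltE; exists (x1 *! w +! x1 *! w +! x1 +! y1 +! y1 +! y1 *! w +! y1 *! w +!
    w *! w +! w +! w +! x2).
  apply: (@addmI _ _ ((x1 +! y1) *! (x1 +! y1))); rewrite [RHS]H; ring.
case: (lt_total (x +! y) (x' +! y')) => [/gap //|[Es|/gap H /esym //]].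
rewrite /pr Es => /addmI Ex; split=> //.
by move: Es; rewrite Ex => /addmI.
Qed.

Lemma projections : exists p1 p2 : M -> M,
  [/\ forall x y, p1 (pr x y) = x, forall x y, p2 (pr x y) = y,
      dtm 1 (fun s : nat -> M => p1 (s 0%N)) & dtm 1 (fun s : nat -> M => p2 (s 0%N))].
Proof.
(* Elements that are not codes are projected to 0, which makes the projections total and still
   definable. *)
have /fchoice [f Hf] : forall z : M, exists xy : M * M,
    (z = pr xy.1 xy.2) \/ (xy = (0, 0) /\ ~ exists x y, z = pr x y).
  move=> z; case: (classic (exists x y, z = pr x y)) => [[x [y ->]]|]; last by exists (0, 0); right.
  by exists (x, y); left.
have fE x y : f (pr x y) = (x, y).
  case: (Hf (pr x y)) => [/pr_inj [E1 E2]|[_ []]]; last by exists x, y.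
  by rewrite [LHS]surjective_pairing -E1 -E2.
exists (fun z => (f z).1), (fun z => (f z).2); split=> [x y|x y||]; rewrite ?fE //.
  apply: (@dfn_iff _ _ _ (fun s : nat -> M => (exists y, s 1%N = pr (s 0%N) y) \/
    s 0%N = 0 /\ ~ exists x y, s 1%N = pr x y)); last by rewrite /pr; dfn_tac.
  move=> s; split=> [[[y ->]|[-> H]]|]; first by rewrite fE.
    by case: (Hf (s 1%N)) => [E|[-> _] //]; case: H; exists (f (s 1%N)).1, (f (s 1%N)).2.
  by move=> ->; case: (Hf (s 1%N)) => [E|[-> H]]; [left; exists (f (s 1%N)).2|right].
apply: (@dfn_iff _ _ _ (fun s : nat -> M => (exists x, s 1%N = pr x (s 0%N)) \/
  s 0%N = 0 /\ ~ exists x y, s 1%N = pr x y)); last by rewrite /pr; dfn_tac.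
move=> s; split=> [[[y ->]|[-> H]]|]; first by rewrite fE.
  by case: (Hf (s 1%N)) => [E|[-> _] //]; case: H; exists (f (s 1%N)).1, (f (s 1%N)).2.
by move=> ->; case: (Hf (s 1%N)) => [E|[-> H]]; [left; exists (f (s 1%N)).1|right].
Qed.

(** * Coding of finite sets by divisibility *)

Definition dvd (x y : M) : Prop := exists z, y = x *! z.

(* Goedel's beta function: [z] belongs to the set coded by [(m, d)] when the
   [z]-th modulus divides [d]. *)
Definition mem (m d z : M) : Prop := dvd (1 +! (z +! 1) *! m) d.

(** In place of subtraction the quotients are compared; the quotient of the sum can be the smaller
    one only if [v] is 0. *)
Lemma dvd_addr x u v : dvd x u -> dvd x (u +! v) -> dvd x v.
Proof.
move=> [p ->] [q E]; case: (lt_total p q) => [/ltE [z Ez]|[Epq|/ltE [z Ez]]].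
- by exists (z +! 1); apply: (@addmI _ _ (x *! p)); rewrite E -Ez; ring.
- by exists 0; apply: (@addmI _ _ (x *! p)); rewrite E Epq; ring.
- have v0 : x *! (z +! 1) +! v = 0.
    by apply: (@addmI _ _ (x *! q)); rewrite addm0 -[RHS]E -Ez; ring.
  have [->|[w Ew]] := zero_or_succ v; first by exists 0; rewrite mulm0.
  by move: v0; rewrite Ew addmS => /succ_neq0.
Qed.

Lemma dvd_mulr x y z : dvd x y -> dvd x (y *! z).
Proof. by move=> [w ->]; exists (w *! z); ring. Qed.

Lemma common_multiple y : exists2 m, m <> 0 & forall k, k <! y -> dvd (k +! 1) m.
Proof.
suff : exists m, m <> 0 /\ forall k, k <! y -> dvd (k +! 1) m by case=> m []; exists m.
elim/ind0: y => [||y [m [m0 Hm]]].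
- by rewrite /dvd; dfn_tac.
- by exists 1; split=> [|k /ltm0 //]; rewrite -(add0m 1); apply: succ_neq0.
- exists (m *! (y +! 1)); split=> [|k /ltmS [/Hm|->]].
  + have [//|[n ->]] := zero_or_succ m.
    have -> : (n +! 1) *! (y +! 1) = (n *! (y +! 1) +! y) +! 1 by ring.
    exact: succ_neq0.
  + exact: dvd_mulr.
  + by exists m; ring.
Qed.

(** The product of [w] and the modulus is [w] plus a multiple of [m *! w], so [m] can be
    cancelled. *)
Lemma modulus_coprime m w i : dvd (1 +! (i +! 1) *! m) (m *! w) -> dvd (1 +! (i +! 1) *! m) w.
Proof.
move=> H; apply: (@dvd_addr _ ((m *! w) *! (i +! 1))); first exact: dvd_mulr.
by exists w; ring.
Qed.

(** The two moduli differ by [(t +! 1) *! m] with [t +! 1] dividing [m], and cancelling [m] twice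
    leaves [d]. *)
Lemma moduli_coprime m y i j d : (forall k, k <! y -> dvd (k +! 1) m) ->
  i <! y -> j <! y -> i <> j ->
  dvd (1 +! (i +! 1) *! m) (d *! (1 +! (j +! 1) *! m)) -> dvd (1 +! (i +! 1) *! m) d.
Proof.
move=> Hm iy jy ij H.
have key t : t <! y -> dvd (1 +! (i +! 1) *! m) ((t +! 1) *! m *! d) ->
    dvd (1 +! (i +! 1) *! m) d.
  move=> /Hm [q Eq] D; apply: modulus_coprime.
  have -> : m *! d = (t +! 1) *! d *! q by rewrite {1}Eq; ring.
  apply: dvd_mulr; apply: modulus_coprime.
  by have -> : m *! ((t +! 1) *! d) = (t +! 1) *! m *! d by ring.
case: (lt_total i j) => [/ltE [t Et]|[//|/ltE [t Et]]].
- apply: (key t); first by apply: lt_trans jy; apply/ltE; exists i; rewrite -Et; ring.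
  apply: (@dvd_addr _ ((1 +! (i +! 1) *! m) *! d)); first by exists d.
  suff -> : (1 +! (i +! 1) *! m) *! d +! (t +! 1) *! m *! d =
    d *! (1 +! (j +! 1) *! m) by [].
  by rewrite -Et; ring.
- apply: (key t); first by apply: lt_trans iy; apply/ltE; exists j; rewrite -Et; ring.
  apply: (dvd_addr H); exists d; rewrite -Et; ring.
Qed.

(** A set is coded by a product of moduli: 1 codes the empty set, and multiplying by the modulus of
    [z] adds [z]. Coprimality of the moduli excludes any other new member below [y]. *)
Lemma set_codes y : exists m, (exists d, forall z, z <! y -> ~ mem m d z) /\
  forall d z, z <! y -> exists d', forall z', z' <! y -> (mem m d' z' <-> mem m d z' \/ z' = z).
Proof.
have [m m0 Hm] := common_multiple y; exists m; split.
  exists 1 => z _ [q].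
  have [E0|[n ->]] := zero_or_succ m; first by [].
  have [->|[r ->]] := zero_or_succ q; first by rewrite mulm0 -(add0m 1) => /succ_neq0.
  have -> : (1 +! (z +! 1) *! (n +! 1)) *! (r +! 1) =
    (z *! n +! z +! n +! r *! (1 +! (z +! 1) *! (n +! 1)) +! 1) +! 1 by ring.
  by rewrite -{1}(add0m 1) => /succ_inj /esym /succ_neq0.
move=> d z zy; exists (d *! (1 +! (z +! 1) *! m)) => z' zy'; split=> [H|[H|->]].
- case: (classic (z' = z)) => [|ne]; [by right|left].
  exact: moduli_coprime Hm _ _ ne H.
- exact: dvd_mulr.
- by exists d; ring.
Qed.

Lemma dfn_mem k t u v : dtm k t -> dtm k u -> dtm k v ->
  dfn k (fun s : nat -> M => mem (t s) (u s) (v s)).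
Proof.
by apply: (@dfn_app3 L M k mem); rewrite /mem /dvd; dfn_tac.
Qed.

Ltac dfn_ext ::= apply: dfn_mem; dtm_tac.

(** * Ehrenfeucht's lemma *)

Section Ehrenfeucht.

Variable F : M -> M -> Prop.
Hypothesis F_dfn : dfn 2 (fun s : nat -> M => F (s 0%N) (s 1%N)).
Hypothesis F_fun : forall x y z, F x y -> F x z -> y = z.
Hypothesis F_lt : forall x y, F x y -> y <! x.

Let F_dfn2 k t u : dtm k t -> dtm k u -> dfn k (fun s : nat -> M => F (t s) (u s)).
Proof. exact: dfn_app2. Qed.

Ltac dfn_ext ::= first [apply: dfn_mem; dtm_tac | apply: F_dfn2; dtm_tac].

(* [(m, d)] codes the 2-colouring of [0, y) in which [x] and [F x] differ. *)
Definition colouring m d y : Prop :=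
  forall x, x <! y -> (mem m d x <-> exists z, F x z /\ ~ mem m d z).

(** Colours are fixed in increasing order; since [F] decreases, the colour of the image of [x] is
    known when [x] is reached. *)
Lemma colouring_exists y : exists m d, colouring m d y.
Proof.
have [m [[d0 Hd0] Hm]] := set_codes y; exists m.
(* Among the elements below [y], the set at stage [k] has no member from [k] on, so a step inserts
   at most [k]. *)
pose Q k m y := exists d, forall x, x <! y ->
  (mem m d x <-> x <! k /\ exists z, F x z /\ ~ mem m d z).
suff HQ k : Q k m y.
  have [d Hd] := HQ y; exists d => x xy; rewrite Hd //; split=> [[] //|?]; split=> //.
apply: (@ind2 Q) => [||{}k [d Hd]]; first by rewrite /Q; dfn_tac.
  exists d0 => x xy; split=> [/Hd0 H|[/ltm0 //]]; by case: H.
case: (classic (k <! y /\ exists z, F k z /\ ~ mem m d z)) => [[ky [w [Fkw nw]]]|H].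
  have [d' Hd'] := Hm d k ky; exists d' => x xy.
  have below z : z <! k -> mem m d' z <-> mem m d z.
    move=> zk; rewrite Hd'; last exact: lt_trans zk ky.
    by split=> [[//|E]|]; [case: (@ltmm k); rewrite -{1}E|left].
  have ex_below x' : x' <! k +! 1 -> (exists z, F x' z /\ ~ mem m d' z) <->
      (exists z, F x' z /\ ~ mem m d z).
    move=> xk; have zk z : F x' z -> z <! k.
      by move/F_lt => zx; case/ltmS: xk => [|<- //]; apply: lt_trans.
    by split=> -[z [Fz nz]]; exists z; split=> //; move: nz; rewrite (below _ (zk z Fz)).
  rewrite Hd' // Hd //; split=> [[[xk Hx]|->]|[/[dup] xk /ltmS [xk'|->] Hx]].
  - have xk1 : x <! k +! 1 by apply/ltmS; left.
    by split=> //; apply/ex_below.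
  - by split; [apply: ltSm|apply/ex_below; [apply: ltSm|exists w]].
  - by left; split=> //; apply/ex_below.
  - by right.
exists d => x xy; rewrite Hd //; split=> -[xk Hx]; split=> //.
  by apply/ltmS; left.
by case/ltmS: xk => // E; case: H; rewrite -E.
Qed.

(** The colour of [x] is determined by that of its smaller image, so two codes agree by strong
    induction. *)
Lemma colouring_unique m d y m' d' y' x : colouring m d y -> colouring m' d' y' ->
  x <! y -> x <! y' -> (mem m d x <-> mem m' d' x).
Proof.
pose Q x m d y m' d' y' := x <! y -> x <! y' -> (mem m d x <-> mem m' d' x).
move=> C C'; suff : Q x m d y m' d' y' by [].
pose s := env_cons m (env_cons d (env_cons y (env_cons m' (env_cons d' (env_cons y' s0))))).
apply: (@dind_strong 6 (fun s => Q (s 0%N) (s 1%N) (s 2) (s 3) (s 4) (s 5) (s 6)) s).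
  by rewrite /Q; dfn_tac.
move=> {}x IH xy xy'; rewrite C // C' //.
by split=> -[z [Fz nz]]; exists z; split=> //;
  have zx := F_lt Fz; have := IH z zx (lt_trans zx xy) (lt_trans zx xy'); simpl; tauto.
Qed.

(** [P] is the colour of [x] in some code of a colouring reaching past [x]; by uniqueness the choice
    of code does not matter. As [b] and [a] differ in colour, either [P] or its negation separates
    them. *)
Lemma ehrenfeucht b a : F b a -> exists P : M -> Prop,
  [/\ dfn 1 (fun s : nat -> M => P (s 0%N)), P b & ~ P a].
Proof.
move=> Fba; pose P x := exists m d, colouring m d (x +! 1) /\ mem m d x.
have dP : dfn 1 (fun s : nat -> M => P (s 0%N)) by rewrite /P /colouring; dfn_tac.
have [m [d C]] := colouring_exists (b +! 1).
have ab := F_lt Fba.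
have Ca : colouring m d (a +! 1).
  move=> x /ltmS xa; apply: C; apply: lt_trans (ltSm b).
  by case: xa => [xa|-> //]; apply: lt_trans ab.
have PE x : colouring m d (x +! 1) -> P x <-> mem m d x.
  move=> Cx; split=> [[m' [d' [C' mx]]]|mx]; last by exists m, d.
  exact/(colouring_unique Cx C' (ltSm x) (ltSm x)).
have key : P b <-> ~ P a.
  rewrite !PE // C; last exact: ltSm.
  by split=> [[z [/(F_fun Fba) <-]] //|na]; exists a.
case: (classic (P b)) => [Pb|nPb].
  by exists P; split=> //; apply/key.
by exists (fun x => ~ P x); split; [apply: dfn_not| |]; tauto.
Qed.

End Ehrenfeucht.

(** * Standard elements, overspill, and codes of external finite lists *)

Definition num (n : nat) : M := iter n (fun x => x +! 1) 0.

Definition nonstandard (c : M) : Prop := forall k, num k <! c.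

Lemma lt_num c k : c <! num k -> exists2 j, j < k & c = num j.
Proof.
elim: k => [/ltm0 //|k IH] /= /ltmS [/IH [j jk ->]|->]; last by exists k.
by exists j => //; apply: leqW.
Qed.

Lemma num_lt j k : j < k -> num j <! num k.
Proof.
elim: k => // k IH; rewrite ltnS leq_eqVlt => /orP [/eqP ->|/IH jk]; first exact: ltSm.
exact: lt_trans jk (ltSm _).
Qed.

Lemma num_lt_inv j k : num j <! num k -> j < k.
Proof.
move=> jk; rewrite ltnNge; apply/negP; rewrite leq_eqVlt => /orP [/eqP E|/num_lt kj].
  by move: jk; rewrite E => /ltmm.
exact: (ltmm (lt_trans jk kj)).
Qed.

Lemma standard_or_nonstandard c : (exists k, c = num k) \/ nonstandard c.
Proof.
case: (classic (nonstandard c)) => [|H]; [by right|left].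
have [k nk] := not_all_ex_not _ _ H; case: (lt_total c (num k)) => [/lt_num [j _ ->]|[->|//]].
  by exists j.
by exists k.
Qed.

(** Otherwise [P] would define the set of standard elements, and induction would make [b]
    standard. *)
Lemma overspill k (P : (nat -> M) -> Prop) s b : dfn k P -> nonstandard b ->
  (forall n, P (env_cons (num n) s)) -> exists2 c, nonstandard c & P (env_cons c s).
Proof.
move=> dP nb Pn; apply: NNPP => H.
have Pstd c : P (env_cons c s) -> exists n, c = num n.
  by move=> Pc; case: (standard_or_nonstandard c) => // nc; case: H; exists c.
have [|n E] := Pstd b; last by have := nb n; rewrite E => /ltmm.
apply: (dind dP); first exact: (Pn 0%N).
by move=> x /Pstd [n ->]; apply: (Pn n.+1).
Qed.

Lemma upper_bound (l : seq M) : exists y, forall z, List.In z l -> z <! y.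
Proof.
elim: l => [|x l [y Hy]]; first by exists 0.
exists (y +! x +! 1) => z [<-|/Hy zy].
  by rewrite (addmC y); apply: lt_addr.
exact: lt_trans zy (lt_addr y x).
Qed.

Lemma finite_set_code (l : seq M) : exists m d y, forall z,
  (z <! y /\ mem m d z) <-> List.In z l.
Proof.
have [y Hy] := upper_bound l; have [m [[d0 Hd0] Hm]] := set_codes y.
suff [d Hd] : exists d, forall z, z <! y -> (mem m d z <-> List.In z l).
  exists m, d, y => z; split=> [[zy /(Hd z zy)] //|/[dup] zl /Hy zy].
  by split=> //; apply/Hd.
elim: l Hy => [|x l IH] Hy; first by exists d0 => z /Hd0 nz; split.
have [|d Hd] := IH; first by move=> z zl; apply: Hy; right.
have [|d' Hd'] := Hm d x; first by apply: Hy; left.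
exists d' => z zy; rewrite Hd' // Hd //=.
by split=> [[|->]|[->|]]; [right|left|right|left].
Qed.


(** * Definable approximations of the back-and-forth relations *)

Section Approximation.

Variables p1 p2 : M -> M.
Hypothesis p1_pr : forall x y, p1 (pr x y) = x.
Hypothesis p2_pr : forall x y, p2 (pr x y) = y.
Hypothesis p1_dtm : dtm 1 (fun s : nat -> M => p1 (s 0%N)).
Hypothesis p2_dtm : dtm 1 (fun s : nat -> M => p2 (s 0%N)).

Local Notation ev := (ev p1 p2).
Local Notation E := (E p1 p2).
Local Notation opf := (opf p1 p2).
Local Notation holds := (holds p1 p2).

Lemma dtm_pr k (t u : (nat -> M) -> M) :
  dtm k t -> dtm k u -> dtm k (fun s => pr (t s) (u s)).
Proof. by move=> dt du; apply: dtm_add => //; apply: dtm_mul; apply: dtm_add. Qed.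

Lemma dtm_opf k o (t u : (nat -> M) -> M) :
  dtm k t -> dtm k u -> dtm k (fun s => opf o (t s) (u s)).
Proof.
move=> dt du; case: o => /= [||||||| c]; try dtm_tac.
- exact: dtm_add.
- exact: dtm_mul.
- exact: dtm_app1 p1_dtm dt.
- exact: dtm_app1 p2_dtm dt.
- exact: dt.
Qed.

Lemma dtm_ev k r (t : (nat -> M) -> M) : dtm k t -> dtm k (fun s => ev (t s) r).
Proof. by move=> dt; elim: r => //= o r1 IH1 r2 IH2; apply: dtm_opf. Qed.

Lemma dtm_dec k j (t : (nat -> M) -> M) : dtm k t -> dtm k (fun s => dec p1 p2 (t s) j).
Proof.
move=> dt; apply: (dtm_app1 p1_dtm); elim: j => //= j IH.
exact: dtm_app1 p2_dtm IH.
Qed.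

Lemma dfn_holds k a (t : (nat -> M) -> M) : dtm k t -> dfn k (fun s => holds a (t s)).
Proof.
move=> dt; case: a => [||r] /=.
- by apply: dfn_eq; apply: dtm_dec.
- by apply: dfn_lt; apply: dtm_dec.
- by apply: (@dfn_rel L M k r (fun j s => dec p1 p2 (t s) j)) => j; apply: dtm_dec.
Qed.

Definition inW m d B i u v : Prop :=
  pr i (pr u v) <! B /\ mem m d (pr i (pr u v)).

(* [W i] is a finite set of pairs (ev x t, ev y t) containing those with t of
   depth at most i; it is required to preserve the atomic relations for i <= c. *)
Definition partial_iso c x y m d B : Prop :=
  [/\ inW m d B 0 x y,
      forall o, List.In o (ops L) -> forall i u v u' v', i <! c ->
        inW m d B i u v -> inW m d B i u' v' ->
        inW m d B (i +! 1) (opf o u u') (opf o v v') &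
      forall a, List.In a (atoms L) -> forall i u v, ~ c <! i -> inW m d B i u v ->
        (holds a u <-> holds a v)].

(** The number of moves [n] is external, so each [R n] is a single formula, whereas the depth bound
    [c] is an element of [M]. *)
Fixpoint R n c x y : Prop :=
  if n is n'.+1 then
    (forall u, exists v, R n' c (pr u x) (pr v y)) /\
    (forall v, exists u, R n' c (pr u x) (pr v y))
  else exists m d B, partial_iso c x y m d B.

Ltac dtm_ext ::= first [apply: dtm_pr; dtm_tac | apply: dtm_opf; dtm_tac].

Lemma dfn_inW k t1 t2 t3 t4 t5 t6 : dtm k t1 -> dtm k t2 -> dtm k t3 ->
  dtm k t4 -> dtm k t5 -> dtm k t6 ->
  dfn k (fun s : nat -> M => inW (t1 s) (t2 s) (t3 s) (t4 s) (t5 s) (t6 s)).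
Proof.
move=> *; apply: dfn_and; first by apply: dfn_lt => //; do 2 apply: dtm_pr => //.
by apply: dfn_mem => //; do 2 apply: dtm_pr => //.
Qed.

Ltac dfn_ext ::= first [apply: dfn_inW; dtm_tac | apply: dfn_holds; dtm_tac].

Lemma R_dfn n : dfn 3 (fun s : nat -> M => R n (s 0%N) (s 1%N) (s 2)).
Proof.
elim: n => [|n IH] /=.
  do 3! apply: dfn_ex.
  apply: (@dfn_iff _ _ _ (fun s : nat -> M =>
    inW (s 2) (s 1%N) (s 0%N) 0 (s 4) (s 5) /\
    (forall o, List.In o (ops L) -> forall i u v u' v', i <! s 3 ->
        inW (s 2) (s 1%N) (s 0%N) i u v -> inW (s 2) (s 1%N) (s 0%N) i u' v' ->
        inW (s 2) (s 1%N) (s 0%N) (i +! 1) (opf o u u') (opf o v v')) /\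
    (forall a, List.In a (atoms L) -> forall i u v, ~ s 3 <! i ->
        inW (s 2) (s 1%N) (s 0%N) i u v -> (holds a u <-> holds a v)))).
    by move=> s; split=> [[? [? ?]]|[? ? ?]].
  apply: dfn_and; first by dfn_tac.
  apply: dfn_and; apply: dfn_allin => o; dfn_tac.
have dR k t u v := @dfn_app3 L M k (R n) t u v IH.
apply: dfn_and; apply: dfn_all; apply: dfn_ex; apply: dR; dtm_tac.
Qed.

(** Every term has standard depth, so for nonstandard [c] its pair of values lies in the coded set
    at a level where the atomic relations are preserved. *)
Lemma R_nonstandard n c x y : nonstandard c -> R n c x y -> E n x y.
Proof.
move=> nc; elim: n x y => [|n IH] x y; last first.
  by move=> [H1 H2]; split=> u; [have [v /IH] := H1 u|have [v /IH] := H2 u]; exists v.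
move=> [m [d [B [W0 WS Wp]]]].
have step o k u v u' v' : inW m d B (num k) u v -> inW m d B (num k) u' v' ->
    inW m d B (num k.+1) (opf o u u') (opf o v v').
  by apply: WS; [apply: ops_all|apply: nc].
have lift k l u v : k <= l -> inW m d B (num k) u v -> inW m d B (num l) u v.
  move=> kl Wk; elim: l kl => [|l IHl]; first by case: k Wk.
  rewrite leq_eqVlt => /orP [/eqP <- //|/IHl Wl].
  exact: (step (oFst L) _ _ _ _ _ Wl Wl).
have W t : exists k, inW m d B (num k) (ev x t) (ev y t).
  elim: t => [|o t1 [k1 W1] t2 [k2 W2]]; first by exists 0%N.
  exists (maxn k1 k2).+1; apply: step.
    by apply: lift W1; apply: leq_maxl.
  by apply: lift W2; apply: leq_maxr.
move=> a t; have [k Wk] := W t.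
apply: (Wp a (atoms_all a) (num k)) Wk => ck.
exact: ltmm (lt_trans ck (nc k)).
Qed.

Definition agree (l : seq (M -> Prop)) (x y : M) : Prop :=
  forall P, List.In P l -> (P x <-> P y).

Definition dfn_list (l : seq (M -> Prop)) : Prop :=
  forall P, List.In P l -> dfn 1 (fun s : nat -> M => P (s 0%N)).

Fixpoint oterms k : seq (oterm L) :=
  if k is k'.+1 then
    map (fun q => Op q.1 q.2.1 q.2.2)
      (List.list_prod (ops L) (List.list_prod (oterms k') (oterms k')))
  else [:: U L].

Fixpoint levels k : seq (nat * oterm L) :=
  map (fun t => (k, t)) (oterms k) ++ (if k is k'.+1 then levels k' else [::]).

Lemma In_levels k j t : List.In (j, t) (levels k) <-> j <= k /\ List.In t (oterms j).
Proof.
elim: k => [|k IH]; rewrite [levels _]/=.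
  split=> [[[<- <-]|//]|[]]; first by split=> //; left.
  by rewrite leqn0 => /eqP -> [<-|//]; left.
split=> [/List.in_app_iff [/List.in_map_iff [r [[<- <-] rk]]|/IH [jk tj]]|].
- by split.
- by split=> //; apply: leqW.
- move=> [jk tj]; apply/List.in_app_iff; move: jk; rewrite leq_eqVlt.
  case/orP => [/eqP Ej|jk]; last by right; apply/IH.
  by left; apply/List.in_map_iff; exists t; move: tj; rewrite Ej.
Qed.

(** The pairs of values of terms of depth up to [k] form a truly finite set, which has a code. It
    preserves the atoms once [x] and [y] agree on finitely many atomic statements. *)
Lemma R0_standard k : exists2 l, dfn_list l & forall x y, agree l x y -> R 0 (num k) x y.
Proof.
exists (map (fun q x => holds q.1 (ev x q.2.2)) (List.list_prod (atoms L) (levels k))).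
  move=> P /List.in_map_iff [[a [j t]] [<- _]] /=.
  by apply: dfn_holds; apply: dtm_ev; apply: dtm_var.
move=> x y Hagree.
have agr a j t : j <= k -> List.In t (oterms j) -> (holds a (ev x t) <-> holds a (ev y t)).
  move=> jk tj; apply: (Hagree (fun x => holds a (ev x t))); apply/List.in_map_iff.
  exists (a, (j, t)); split=> //; apply: List.in_prod; first exact: atoms_all.
  exact/In_levels.
pose code (q : nat * oterm L) := pr (num q.1) (pr (ev x q.2) (ev y q.2)).
have [m [d [B HB]]] := finite_set_code (map code (levels k)).
have inWE i u v : inW m d B i u v <-> exists j t,
    [/\ j <= k, List.In t (oterms j), i = num j, u = ev x t & v = ev y t].
  rewrite /inW HB; split=> [/List.in_map_iff [[j t] [/pr_inj [<- /pr_inj [<- <-]]]]|].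
    by move/In_levels => [jk tj]; exists j, t.
  move=> [j [t [jk tj -> -> ->]]]; apply/List.in_map_iff; exists (j, t).
  by split=> //; apply/In_levels.
exists m, d, B; split.
- by apply/inWE; exists 0%N, (U L); split=> //; left.
- move=> o Ho i u v u' v' ik /inWE [j [t [jk tj Ei -> ->]]] /inWE [j' [t' [_ tj' Ei' -> ->]]].
  move: ik; rewrite Ei => /num_lt_inv jk'.
  have Ej : j' = j.
    by case: (ltngtP j' j) => // /num_lt; rewrite -Ei -Ei' => /ltmm.
  apply/inWE; exists j.+1, (Op o t t'); split=> //.
  apply/List.in_map_iff; exists (o, (t, t')); split=> //.
  by do 2! [apply: List.in_prod => //]; rewrite -Ej.
- by move=> a _ i u v _ /inWE [j [t [jk tj _ -> ->]]]; apply: agr jk tj.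
Qed.

(** The complete types over the finite list [l]. *)
Fixpoint patterns (l : seq (M -> Prop)) : seq (M -> Prop) :=
  if l is P :: l' then
    map (fun Q x => P x /\ Q x) (patterns l') ++ map (fun Q x => ~ P x /\ Q x) (patterns l')
  else [:: fun=> True].

Lemma patterns_dfn l : dfn_list l -> dfn_list (patterns l).
Proof.
elim: l => [_ Q [<-|//]|P l IH Hl Q].
  by exists (fAll (fEq (tVar 0) (tVar 0))); split.
have dP := Hl P (or_introl erefl).
have dl : dfn_list (patterns l) by apply: IH => P' lP'; apply: Hl; right.
by case/List.in_app_iff => /List.in_map_iff [Q' [<- /dl dQ']]; apply: dfn_and => //;
  apply: dfn_not.
Qed.

Lemma patterns_cover l x : exists2 Q, List.In Q (patterns l) & Q x.
Proof.
elim: l => [|P l [Q lQ Qx]]; first by exists (fun=> True) => //; left.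
case: (classic (P x)) => Px.
  exists (fun x => P x /\ Q x) => //; apply/List.in_app_iff; left.
  by apply/List.in_map_iff; exists Q.
exists (fun x => ~ P x /\ Q x) => //; apply/List.in_app_iff; right.
by apply/List.in_map_iff; exists Q.
Qed.

Lemma patterns_agree l Q x y : List.In Q (patterns l) -> Q x -> Q y -> agree l x y.
Proof.
elim: l Q => [|P l IH] Q; first by move=> _ _ _ P [].
case/List.in_app_iff => /List.in_map_iff [Q' [<- lQ']] [Px Qx] [Py Qy] P' [<-|lP'] //;
  exact: IH lQ' Qx Qy P' lP'.
Qed.

(** As with Hintikka formulas, one more move asks which patterns over the previous list are realized
    by extending the tuple. *)
Lemma R_standard n k :
  exists2 l, dfn_list l & forall x y, agree l x y -> R n (num k) x y.
Proof.
elim: n => [|n [l dl Hl]]; first exact: R0_standard.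
exists (map (fun Q x => exists u, Q (pr u x)) (patterns l)).
  move=> P /List.in_map_iff [Q [<- /(patterns_dfn dl) dQ]].
  by apply: dfn_ex; apply: (dfn_app1 dQ); dtm_tac.
move=> x y agr.
have ex u z z' : agree (map (fun Q x => exists u, Q (pr u x)) (patterns l)) z z' ->
    exists v, agree l (pr u z) (pr v z').
  move=> zz'; have [Q lQ Qu] := patterns_cover l (pr u z).
  have [v Qv] := (zz' _ (In_map (fun Q x => exists u, Q (pr u x)) lQ)).1 (ex_intro _ u Qu).
  by exists v; apply: patterns_agree lQ Qu Qv.
split=> u; first by have [v Hv] := ex u _ _ agr; exists v; apply: Hl.
have [|v Hv] := ex u y x; first by move=> P lP; rewrite (agr P lP).
by exists v; apply: Hl => P lP; rewrite (Hv P lP).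
Qed.

Lemma definable_dfn b (P : M -> Prop) : dfn 1 (fun s : nat -> M => P (s 0%N)) ->
  (forall x, P x <-> x = b) -> definable_element b.
Proof.
move=> [phi [fp bp H]] Pb; exists phi; split=> //; split=> // a s.
by rewrite H Pb.
Qed.

Lemma definable_num k : definable_element (num k).
Proof.
apply: (@definable_dfn _ (fun x => x = num k)) => //; apply: dfn_eq; first exact: dtm_var.
by elim: k => [|k IH]; [apply: dtm_zero|apply: dtm_add IH (dtm_one _ _)].
Qed.

Ltac dfn_ext ::= first [apply: (@dfn_app3 L M _ (R _)); [exact: R_dfn|dtm_tac..]].

Lemma R_below_nonstandard n b : ~ definable_element b -> exists c x,
  [/\ nonstandard c, c <! b, x <! b & R n c x b].
Proof.
move=> b_undef.
have nb : nonstandard b.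
  case: (standard_or_nonstandard b) => // -[k Ek]; case: b_undef; rewrite Ek.
  exact: definable_num.
pose T c z := c <! z /\ exists x, x <! z /\ R n c x z.
have dT : dfn 2 (fun s : nat -> M => T (s 0%N) (s 1%N)) by rewrite /T; dfn_tac.
case: (classic (forall k, T (num k) b)) => [Tk|/not_all_ex_not [k nT]].
  have [c nc [/= cb [x [xb Rx]]]] :=
    @overspill 2 (fun s => T (s 0%N) (s 1%N)) (env_cons b s0) b dT nb Tk.
  by exists c, x.
(* If [T] fails at a standard [k], no smaller element has the pattern of [b], so [b] is definable as
   the least element of its pattern. *)
case: b_undef; have [l dl Hl] := R_standard n k.
have [Q lQ Qb] := patterns_cover l b.
have dQ := patterns_dfn dl lQ.
have dQ' j t : dtm j t -> dfn j (fun s : nat -> M => Q (t s)) := dfn_app1 dQ.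
apply: (@definable_dfn _ (fun x => Q x /\ forall y, y <! x -> ~ Q y)).
  apply: dfn_and; first exact: dQ.
  apply: dfn_all; apply: dfn_imp; first by dfn_tac.
  by apply: dfn_not; apply: dQ'; dtm_tac.
have minb y : y <! b -> ~ Q y.
  move=> yb Qy; apply: nT; split; first exact: nb.
  by exists y; split=> //; apply: Hl; apply: patterns_agree lQ Qy Qb.
move=> x; split=> [[Qx minx]|-> //].
case: (lt_total x b) => [/minb //|[//|/minx]]; by case.
Qed.

Lemma indiscernible_conjugate n b : ~ definable_element b ->
  exists b' chi, [/\ E n b' b, finitary chi, free_below 1 chi,
    sat (env_cons b s0) chi & ~ sat (env_cons b' s0) chi].
Proof.
move=> /(R_below_nonstandard n) [c0 [x0 [nc0 /ltE [j0 Ej0] x0b R0]]].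
pose T c z := exists x, x <! z /\ R n c x z.
(* [j] plays the role of [z - c], so that the largest [c] becomes the least [j]. *)
pose J j z := exists c, c +! j = z /\ T c z.
(* [F] sends [z] to the least [x] related to it for the largest possible [c]: a partial function
   definable without parameters, as Ehrenfeucht's lemma demands. *)
pose F z x := x <! z /\ exists j, (J j z /\ forall j', j' <! j -> ~ J j' z) /\
  exists c, c +! j = z /\ R n c x z /\ forall y, y <! x -> ~ R n c y z.
have dJ : dfn 2 (fun s : nat -> M => J (s 0%N) (s 1%N)) by rewrite /J /T; dfn_tac.
have [j [c [Ecj [x [xb Rx]]]] minj] :=
  @least 1 (fun s => J (s 0%N) (s 1%N)) (env_cons b s0) (j0 +! 1) dJ
    (ex_intro _ c0 (conj Ej0 (ex_intro _ x0 (conj x0b R0)))).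
rewrite /= in Ecj xb Rx minj.
(* By maximality [c] is not below the nonstandard [c0]. *)
have nc : nonstandard c.
  move=> k; apply: NNPP => kc.
  have cc0 : c <! c0.
    case: (lt_total c (num k)) => [ck|[->|//]]; last exact: nc0.
    exact: lt_trans ck (nc0 k).
  have [w Ew] := (ltE c c0).1 cc0.
  apply: (minj (j0 +! 1)); last by exists c0; split=> //; exists x0.
  apply/ltE; exists w; apply: (@addmI _ _ c); rewrite Ecj -Ej0 -Ew; ring.
have [y Ry miny] := @least 2 (fun s => R n (s 1%N) (s 0%N) (s 2))
  (env_cons c (env_cons b s0)) x (ltac:(dfn_tac)) Rx.
rewrite /= in Ry miny.
have yb : y <! b.
  case: (lt_total x y) => [/miny //|[<- //|yx]]; exact: lt_trans yx xb.
have Fby : F b y.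
  split=> //; exists j; split; last by exists c.
  by split=> //; exists c; split=> //; exists x.
have F_fun z u v : F z u -> F z v -> u = v.
  move=> [_ [i [[Ji mini] [e [Ee [Ru minu]]]]]] [_ [i' [[Ji' mini'] [e' [Ee' [Rv minv]]]]]].
  have Ei : i = i' by case: (lt_total i i') => [/mini' //|[//|/mini]].
  have Ee2 : e = e' by apply: (@addIm _ _ i); rewrite Ee Ei Ee'.
  case: (lt_total u v) => [/minv|[//|/minu]]; first by rewrite -Ee2.
  by rewrite Ee2.
have F_dfn : dfn 2 (fun s : nat -> M => F (s 0%N) (s 1%N)).
  by rewrite /F /J /T; dfn_tac.
have F_lt z u : F z u -> u <! z by case.
have [P [[chi [fc bc Hchi]] Pb nPy]] := ehrenfeucht F_dfn F_fun F_lt Fby.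
exists y, chi; split=> //; [exact: R_nonstandard nc Ry|exact/Hchi|by move/Hchi].
Qed.

End Approximation.

Lemma infinite_model l (g : nat -> M) : exists a, forall i, i < l -> g i <> a.
Proof.
suff [a Ha] : exists a, forall i, i < l -> g i <! a.
  by exists a => i /Ha + E; rewrite E => /ltmm.
elim: l => [|l [a Ha]]; first by exists 0.
exists (g l +! a +! 1) => i; rewrite ltnS leq_eqVlt => /orP [/eqP ->|/Ha ia].
  exact: lt_addr.
by apply: lt_trans ia _; rewrite (addmC (g l)); apply: lt_addr.
Qed.

End Arithmetic.

(** * Excluding Scott sentences at level omega plus one *)

Lemma models_fAlls L (A : structure L) k (p : formula L) :
  (forall s : nat -> A, sat s (fAlls k p)) -> forall s : nat -> A, sat s p.
Proof.
elim: k => // k IH H; apply: IH => s.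
have := H (fun i => s i.+1) (s 0).
by have -> : env_cons (s 0) (fun i => s i.+1) = s by apply: functional_extensionality; case.
Qed.

Lemma no_Pi_omega_succ_scott_sentence L (M : structure L) (b : M) a :
  models_PA M -> countable_structure M -> ~ definable_element b -> ole a oomega ->
  ~ has_Pi_scott_sentence M (osucc a).
Proof.
move=> hPA cM b_undef a_omega [phi [Pphi scott_phi]].
have [e e_surj] := countable_enum cM.
have [p1 [p2 [p1_pr p2_pr p1_dtm p2_dtm]]] := projections hPA.
have M_phi : models M phi by apply/(scott_phi.2 M cM)/isomorphic_refl.
move Ea': (osucc a) Pphi => a' Pphi.
case: Pphi Ea' scott_phi M_phi => {phi} [a'' phi a0 _ _ Ea|a'' g k psi ga psi_Sigma Ea].
  (* A successor is not at most zero, so [phi] is a conjunction of universal blocks over Sigma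
     formulas. *)
  by move: a0; rewrite -Ea => /(_ tt) [].
rewrite -Ea in ga => scott_phi M_phi.
have conj x : ~ definable_element x -> forall n, _ :=
  fun ux n => indiscernible_conjugate hPA p1_dtm p2_dtm n ux.
have g_omega i : ole (g i) oomega by have [_ ai] := ga i; apply: ole_trans a_omega.
have M_psi i (s : nat -> M) : sat s (psi i).
  by apply: (@models_fAlls _ _ (k i)) s => s; apply: (M_phi s).
exact: (not_scott_sentence p1_pr p2_pr (infinite_model hPA) e_surj b_undef conj
  g_omega psi_Sigma M_psi scott_phi).
Qed.

Theorem theorem4p7 (L : language) (M : structure L)
    (hPA : models_PA M) (hcount : countable_structure M)
    (b : M) (hb : ~ definable_element b) :
  exists a : ordinal_tree, is_scott_rank M a /\ olt oomega a.
Proof.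
have [a0 Ha0] := Pi_scott_sentence_exists hcount.
have [a Ha a_least] := @ole_least (fun a => has_Pi_scott_sentence M (osucc a)) a0 Ha0.
exists a; split=> //; have [a_omega|//] := ole_olt a oomega.
by case: (no_Pi_omega_succ_scott_sentence hPA hcount hb a_omega).
Qed.
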